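(* Let $n\in\mathbb N$ and let $u$ be real-valued with $u\in C^\infty(\mathbb R)$, $\partial_x^ku\in L^\infty(\mathbb R)$ for $k=0,1,2$, $4u-u_{xx}>0$ on $\mathbb R$, satisfying $\mathrm{s\text{-}CH}_n(u)=0$, and suppose the associated polynomial is $R_{2n+2}(z)=\prod_{m=0}^{2n+1}(z-E_m)$ with $E_0<E_1<\cdots<E_{2n}<E_{2n+1}=0$. Then the zeros $\mu_j(x)$ and $\nu_j(x)$ of $F_n(\cdot,x)$ and $H_n(\cdot,x)$ are real and, ordered increasingly, satisfy $$\mu_j(x)\in[E_{2j-1},E_{2j}],\qquad \nu_j(x)\in[E_{2j-1},E_{2j}],\qquad j=1,\dots,n,\ x\in\mathbb R.$$ Moreover $\hat\mu_j\in C^\infty(\mathbb R,\mathcal K_n)$, $j=1,\dots,n$, and $\{\hat\mu_j\}$ satisfies the Dubrovin equations on all of $\mathbb R$; $\hat\mu_j(x)$ changes sheets whenever $\mu_j(x)$ hits $E_{2j-1}$ or $E_{2j}$.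
   Context: Stationary CH formalism. Let $n\in\mathbb N$ and $u$ real-valued, $C^\infty$ with bounded derivatives. Let $\mathcal G=(-d^2/dx^2+4)^{-1}$, i.e. $(\mathcal Gv)(x)=\frac14\int_{\mathbb R}e^{-2|x-y|}v(y)\,dy$ on $L^\infty(\mathbb R)$. Put $f_0=1$ and for $\ell\ge1$ define $f_\ell$ by $f_{\ell,x}=-2\mathcal G\big(2(4u-u_{xx})f_{\ell-1,x}+(4u_x-u_{xxx})f_{\ell-1}\big)$, $f_\ell$ being fixed up to an additive integration constant $c_\ell$ (e.g. $f_1=-2u+c_1$). Set $g_\ell=f_\ell+\frac12f_{\ell,x}$, $h_\ell=(4u-u_{xx})f_\ell-g_{\ell+1,x}$ for $0\le\ell\le n-1$, $h_n=(4u-u_{xx})f_n$, and $F_n(z,x)=\sum_{\ell=0}^nf_{n-\ell}(x)z^\ell$, $G_n(z,x)=\sum_{\ell=0}^ng_{n-\ell}(x)z^\ell$, $H_n(z,x)=\sum_{\ell=0}^nh_{n-\ell}(x)z^\ell$. The $n$th stationary CH equation is $\mathrm{s\text{-}CH}_n(u):=(u_{xxx}-4u_x)f_n-2(4u-u_{xx})f_{n,x}=0$; when it holds, $R_{2n+2}(z):=z^2G_n(z,x)^2+zF_n(z,x)H_n(z,x)$ is independent of $x$, monic of degree $2n+2$, with $R_{2n+2}(0)=0$. $\mathcal K_n$ is the hyperelliptic curve $y^2=R_{2n+2}(z)$ compactified by two points at infinity. The zeros of the monic polynomial $F_n(\cdot,x)$ are $\mu_1(x),\dots,\mu_n(x)$;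 $H_n(z,x)=h_0(x)\prod_{j=1}^n(z-\nu_j(x))$ with $h_0=4u+2u_x$; and $\hat\mu_j(x)=(\mu_j(x),-\mu_j(x)G_n(\mu_j(x),x))\in\mathcal K_n$. The Dubrovin equations are $\mu_{j,x}(x)=\frac{2\,y(\hat\mu_j(x))}{\mu_j(x)}\prod_{\ell\ne j}(\mu_j(x)-\mu_\ell(x))^{-1}$, $j=1,\dots,n$, where $y(\hat\mu_j)$ denotes the $y$-coordinate of $\hat\mu_j$ (interpreted in local coordinates $\pm(z-E_m)^{1/2}$ near branch points). *)

(* Defs.v *)
From Stdlib Require Import Reals.
From Coquelicot Require Import Coquelicot.
Open Scope R_scope.

Definition dx1 (u : R -> R) : R -> R := Derive_n u 1.
Definition dx2 (u : R -> R) : R -> R := Derive_n u 2.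
Definition dx3 (u : R -> R) : R -> R := Derive_n u 3.

Definition smooth (v : R -> R) : Prop :=
  forall (k : nat) (x : R), ex_derive (Derive_n v k) x.

(* the integrand of G applied to 2(4u-u_xx) f_{l-1,x} + (4u_x-u_xxx) f_{l-1},
   at the point x, as a function of y *)
Definition rec_rhs (u : R -> R) (f : nat -> R -> R) (l : nat) (y : R) : R :=
  2 * (4 * u y - dx2 u y) * Derive (f (l - 1)%nat) y
  + (4 * dx1 u y - dx3 u y) * f (l - 1)%nat y.

Definition gfun (f : nat -> R -> R) (l : nat) (x : R) : R :=
  f l x + / 2 * Derive (f l) x.

Definition hfun (n : nat) (u : R -> R) (f : nat -> R -> R) (l : nat) (x : R) : R :=
  if Nat.ltb l n then (4 * u x - dx2 u x) * f l x - Derive (gfun f (S l)) x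
  else (4 * u x - dx2 u x) * f l x.

Definition Fpoly (n : nat) (f : nat -> R -> R) (z x : R) : R :=
  sum_f_R0 (fun l => f (n - l)%nat x * z ^ l) n.
Definition Gpoly (n : nat) (f : nat -> R -> R) (z x : R) : R :=
  sum_f_R0 (fun l => gfun f (n - l)%nat x * z ^ l) n.
Definition Hpoly (n : nat) (u : R -> R) (f : nat -> R -> R) (z x : R) : R :=
  sum_f_R0 (fun l => hfun n u f (n - l)%nat x * z ^ l) n.

Definition sCH (n : nat) (u : R -> R) (f : nat -> R -> R) (x : R) : R :=
  (dx3 u x - 4 * dx1 u x) * f n x - 2 * (4 * u x - dx2 u x) * Derive (f n) x.

Fixpoint prodn (F : nat -> R) (k : nat) : R :=
  match k with
  | O => 1
  | S k' => prodn F k' * F k'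
  end.

(* Main.v *)
Require Import Defs.
From Stdlib Require Import Reals.
From Coquelicot Require Import Coquelicot.
From Stdlib Require Import Lra Lia Psatz List Classical ClassicalEpsilon.
Open Scope R_scope.

(** Write w = 4u - u_xx. The recursion and the stationary equation amount to
    F_x = 2G - 2F, zG_x = wF - H, H_x = 2H - 2wG, and the coefficients of F, G, H
    grow slower than any exponential in x.

    For z in the upper half-plane and s^2 = R(z) the matrix
    ((F, G - s/z), (G + s/z, -H/z)) has rank one, so it is the product of two
    vectors (psi, kap), which formally solve psi_x = kap - psi,
    z kap_x = w psi + z kap. The energy Im(z kap psi^* ) - eta |psi|^2 of such a
    solution has a positive definite derivative in which w cancels. The product T
    of the two energies is a polynomial in F, G, H and their conjugates, it obeys
    |T_x| >= c T wherever T > 0, and it grows slower than e^{c|x|}; hence T <= 0,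
    and then neither energy can vanish. Consequently
    Im((zG + s) F^* ) - Im(z) |F|^2 has no zero in the upper half-plane. On a band,
    where R < 0, it equals Im(s) F, and Im(s) alternates from band to band, so F
    changes sign across every gap; so does H because FH > 0 on the bands. This
    locates the n zeros of F and of H.

    The zeros mu_j stay apart from each other, so F_x = 2G at mu_j gives the
    Dubrovin equations and, by bootstrapping, smoothness. Where mu_j meets a branch
    point, y(mu_j) = -mu_j G vanishes with x-derivative H(mu_j), which is nonzero
    because R has simple zeros. *)

(** At eta = Im z the energy is Im(z psi_x conj(psi)), so its nonvanishing says that the Weyl-type
    quotient z psi_x / psi is never real in the upper half-plane, a property that a spectral proof
    would take from self-adjointness. For eta = 0 the derivative of the energy is only Im z |kap|^2,
    which does not control psi; subtracting eta |psi|^2 makes it definite for 0 < eta < 2 Im z, and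
    working on an interval of eta leaves room to vary it.

    The vectors (psi, kap) are factored out separately at each x and never differentiated: only T
    is, as an expression in F, G, H. The product of the two energies is used because it contains s
    only through |s|^2 and does not change when one vector is rescaled against the other.

    The constant c obtained here tends to 0 as z nears the real axis, so the coefficients must grow
    slower than every exponential. The obstacle to this is the source term of the recursion, which
    contains u_xxx without any assumed bound. *)

Lemma is_derive_eq (v : R -> R) (x d d' : R) :
  is_derive v x d -> d = d' -> is_derive v x d'.
Proof. now intros H <-. Qed.

Lemma is_derive_continuity_pt (v : R -> R) (x d : R) :
  is_derive v x d -> continuity_pt v x.
Proof.
  intros H. apply continuity_pt_filterlim.
  apply (ex_derive_continuous v). now exists d.
Qed.

Lemma is_derive_sum (a da : nat -> R -> R) (N : nat) (x : R) :
  (forall k, (k <= N)%nat -> is_derive (a k) x (da k x)) ->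
  is_derive (fun t => sum_f_R0 (fun k => a k t) N) x
            (sum_f_R0 (fun k => da k x) N).
Proof.
  induction N as [|N IH]; intros H; simpl.
  - apply (is_derive_ext (a 0%nat)); [easy | now apply H].
  - apply @is_derive_plus; [apply IH; intros; apply H; lia | apply H; lia].
Qed.

Lemma nondecreasing_of_derive_ge0 (v dv : R -> R) (a b : R) :
  a <= b -> (forall x, a <= x <= b -> is_derive v x (dv x)) ->
  (forall x, a <= x <= b -> 0 <= dv x) -> v a <= v b.
Proof.
  intros Hab Hd Hp.
  destruct (MVT_gen v a b dv) as [c [Hc He]].
  - intros x Hx. rewrite Rmin_left, Rmax_right in Hx by lra. apply Hd; lra.
  - intros x Hx. rewrite Rmin_left, Rmax_right in Hx by lra.
    eapply is_derive_continuity_pt, Hd; lra.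
  - rewrite Rmin_left, Rmax_right in Hc by lra.
    specialize (Hp c Hc). nra.
Qed.

(** * Functions differentiable k times *)

(** Each derivative is an existential witness instead of a [Derive_n], so closure under products and
    inverses is an induction on [k] without a Leibniz formula. *)
Fixpoint diffn (k : nat) (v : R -> R) : Prop :=
  match k with
  | O => True
  | S k' => exists v', (forall x, is_derive v x (v' x)) /\ diffn k' v'
  end.

Lemma diffn_ext (k : nat) (v w : R -> R) :
  (forall x, v x = w x) -> diffn k v -> diffn k w.
Proof.
  destruct k as [|k]; [easy|]; intros He [v' [Hd Hk]].
  exists v'. split; [|easy].
  intros x. apply (is_derive_ext v); [easy | apply Hd].
Qed.

Lemma diffn_pred (k : nat) (v : R -> R) : diffn (S k) v -> diffn k v.
Proof.
  revert v; induction k as [|k IH]; intros v; [easy|].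
  intros [v' [Hd Hk]]. exists v'. split; [easy | now apply IH].
Qed.

Lemma diffn_const (k : nat) (c : R) : diffn k (fun _ => c).
Proof.
  revert c; induction k as [|k IH]; intros c; [easy|].
  exists (fun _ => 0). split; [|apply IH].
  intros x. apply @is_derive_const.
Qed.

Lemma diffn_plus (k : nat) (v w : R -> R) :
  diffn k v -> diffn k w -> diffn k (fun x => v x + w x).
Proof.
  revert v w; induction k as [|k IH]; intros v w; [easy|].
  intros [v' [Hv Kv]] [w' [Hw Kw]].
  exists (fun x => v' x + w' x). split; [|now apply IH].
  intros x. now apply @is_derive_plus.
Qed.

Lemma diffn_mult (k : nat) (v w : R -> R) :
  diffn k v -> diffn k w -> diffn k (fun x => v x * w x).
Proof.
  revert v w; induction k as [|k IH]; intros v w; [easy|].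
  intros Dv Dw.
  generalize (diffn_pred _ _ Dv) (diffn_pred _ _ Dw); intros Dv' Dw'.
  destruct Dv as [v' [Hv Kv]], Dw as [w' [Hw Kw]].
  exists (fun x => v' x * w x + v x * w' x).
  split; [|apply diffn_plus; now apply IH].
  intros x. now apply Derive.is_derive_mult.
Qed.

Lemma diffn_scal (k : nat) (c : R) (v : R -> R) :
  diffn k v -> diffn k (fun x => c * v x).
Proof. intros H. apply diffn_mult; [apply diffn_const | easy]. Qed.

Lemma diffn_minus (k : nat) (v w : R -> R) :
  diffn k v -> diffn k w -> diffn k (fun x => v x - w x).
Proof.
  intros Hv Hw. apply (diffn_ext k (fun x => v x + (-1) * w x)).
  - intros; ring.
  - now apply diffn_plus; [|apply diffn_scal].
Qed.

Lemma diffn_inv (k : nat) (v : R -> R) :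
  (forall x, v x <> 0) -> diffn k v -> diffn k (fun x => / v x).
Proof.
  intros Hn; induction k as [|k IH]; [easy|].
  intros Dv. generalize (diffn_pred _ _ Dv); intros Dv'.
  destruct Dv as [v' [Hv Kv]].
  exists (fun x => (-1) * v' x * (/ v x * / v x)). split.
  - intros x. eapply is_derive_eq; [apply is_derive_inv; [apply Hv | apply Hn]|].
    field. apply Hn.
  - repeat apply diffn_mult; auto. apply diffn_const.
Qed.

Lemma diffn_pow (k : nat) (v : R -> R) (m : nat) :
  diffn k v -> diffn k (fun x => v x ^ m).
Proof.
  intros Hv; induction m as [|m IH]; simpl.
  - apply diffn_const.
  - now apply diffn_mult.
Qed.

Lemma diffn_sum (k : nat) (a : nat -> R -> R) (N : nat) :
  (forall i, (i <= N)%nat -> diffn k (a i)) ->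
  diffn k (fun x => sum_f_R0 (fun i => a i x) N).
Proof.
  induction N as [|N IH]; intros H; simpl; [apply H; lia|].
  apply diffn_plus; [apply IH; intros; apply H; lia | apply H; lia].
Qed.

Lemma diffn_prodn (k : nat) (a : nat -> R -> R) (N : nat) :
  (forall i, (i < N)%nat -> diffn k (a i)) ->
  diffn k (fun x => prodn (fun i => a i x) N).
Proof.
  induction N as [|N IH]; intros H; simpl; [apply diffn_const|].
  apply diffn_mult; [apply IH; intros; apply H; lia | apply H; lia].
Qed.

Lemma diffn_deriv (v dv : R -> R) :
  (forall x, is_derive v x (dv x)) -> (forall k, diffn k v) -> forall k, diffn k dv.
Proof.
  intros Hd Hv k. destruct (Hv (S k)) as [v' [Hv' K]].
  apply (diffn_ext k v'); [|easy].
  intros x. now rewrite <- (is_derive_unique _ _ _ (Hd x)), (is_derive_unique _ _ _ (Hv' x)).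
Qed.

Lemma diffn_of_smooth (v : R -> R) : smooth v -> forall k, diffn k v.
Proof.
  intros Hs k.
  enough (H : forall j, diffn k (Derive_n v j)) by apply (H 0%nat).
  induction k as [|k IH]; intros j; [easy|].
  exists (Derive_n v (S j)). split; [|apply IH].
  intros x. apply Derive_correct, Hs.
Qed.

Lemma smooth_of_diffn (v : R -> R) : (forall k, diffn k v) -> smooth v.
Proof.
  intros Hv k. generalize (Hv (S k)). clear Hv.
  revert v; induction k as [|k IH]; intros v [v' [Hd Hk]] x.
  - now exists (v' x).
  - apply (ex_derive_ext (Derive_n (Derive_n v 1) k)).
    + intros t. rewrite Derive_n_comp. f_equal. lia.
    + apply IH. apply (diffn_ext _ v'); [|easy].
      intros t. symmetry. apply is_derive_unique, Hd.
Qed.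

(** Bootstrapping: the equation expresses the derivative through [v] itself, so each order of
    differentiability yields the next. *)
Lemma diffn_linear_ode (c : R) (v r : R -> R) :
  (forall x, is_derive v x (c * v x + r x)) -> (forall k, diffn k r) ->
  forall k, diffn k v.
Proof.
  intros Hd Hr; induction k as [|k IH]; [easy|].
  exists (fun x => c * v x + r x). split; [easy|].
  apply diffn_plus; [now apply diffn_scal | apply Hr].
Qed.

Lemma diffn_continuous (v : R -> R) : diffn 1 v -> forall x, continuous v x.
Proof.
  intros [v' [Hd _]] x. apply (ex_derive_continuous v). now exists (v' x).
Qed.

(** * The Green function of -d²/dx² + 4 *)

(** [is_RInt_gen] provides a joint limit in both endpoints; this lemma and the next recover the
    limit at one endpoint for a function of that endpoint alone. *)
Lemma filterlim_prod_fst (F G : (R -> Prop) -> Prop) {FF : ProperFilter' F}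
  {FG : ProperFilter' G} (a : R -> R) (l : R) :
  filterlim (fun t : R * R => a (fst t)) (filter_prod F G) (locally l) ->
  filterlim a F (locally l).
Proof.
  intros H P HP. destruct (H P HP) as [Q1 Q2 H1 H2 HQ].
  unfold filtermap.
  apply (filter_imp Q1); [|easy].
  intros x Hx. apply NNPP. intros Hn.
  apply (filter_not_empty (F := G)). apply (filter_imp Q2); [|easy].
  intros y Hy. apply Hn. apply (HQ x y Hx Hy).
Qed.

Lemma filterlim_prod_snd (F G : (R -> Prop) -> Prop) {FF : ProperFilter' F}
  {FG : ProperFilter' G} (a : R -> R) (l : R) :
  filterlim (fun t : R * R => a (snd t)) (filter_prod F G) (locally l) ->
  filterlim a G (locally l).
Proof.
  intros H P HP. destruct (H P HP) as [Q1 Q2 H1 H2 HQ].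
  unfold filtermap.
  apply (filter_imp Q2); [|easy].
  intros y Hy. apply NNPP. intros Hn.
  apply (filter_not_empty (F := F)). apply (filter_imp Q1); [|easy].
  intros x Hx. apply Hn. apply (HQ x y Hx Hy).
Qed.

Lemma is_RInt_continuous_primitive (r p : R -> R) (a b : R) :
  (forall x, continuous r x) -> (forall x, is_derive p x (r x)) ->
  is_RInt r a b (p b - p a).
Proof.
  intros Hr Hp. apply (is_RInt_derive p r); intros x _; auto.
Qed.

Lemma ex_primitive (r : R -> R) :
  (forall x, continuous r x) -> exists p, forall x, is_derive p x (r x).
Proof.
  intros Hr. exists (fun x => RInt r 0 x). intros x.
  apply (is_derive_RInt r _ 0); [|easy].
  apply filter_forall. intros y. apply (@RInt_correct R_CompleteNormedModule).
  apply (@ex_RInt_continuous R_CompleteNormedModule). intros; apply Hr.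
Qed.

(* On a < x < b the integral is a combination of [al a] and [be b], where [al]
   and [be] are primitives of e^{2y} r and e^{-2y} r; two values of x separate
   the limits of [al] and [be]. *)
Lemma green_split (r I : R -> R) :
  (forall x, continuous r x) ->
  (forall x, is_RInt_gen (fun y => exp (-2 * Rabs (x - y)) * r y)
       (Rbar_locally m_infty) (Rbar_locally p_infty) (I x)) ->
  exists U V : R -> R,
    (forall x, I x = U x + V x)
    /\ (forall x, is_derive U x (-2 * U x + r x))
    /\ (forall x, is_derive V x (2 * V x - r x))
    /\ filterlim (fun x => exp (2 * x) * U x) (Rbar_locally m_infty) (locally 0)
    /\ filterlim (fun x => exp (-2 * x) * V x) (Rbar_locally p_infty) (locally 0).
Proof.
  intros Hr HI.
  assert (Ce : forall c x, continuous (fun y => exp (c * y) * r y) x).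
  { intros c x. apply (continuous_mult (fun y => exp (c * y)) r); [|apply Hr].
    apply (ex_derive_continuous (fun y => exp (c * y))). auto_derive; easy. }
  destruct (ex_primitive _ (Ce 2)) as [al Hal].
  destruct (ex_primitive _ (Ce (-2))) as [be Hbe].
  (* Closed form of the truncated integral: on either side of [x] the kernel is an exponential in
     [x] times an exponential in [y]. *)
  set (J := fun (x : R) (t : R * R) =>
    exp (-2 * x) * (al x - al (fst t)) + exp (2 * x) * (be (snd t) - be x)).
  assert (Hint : forall x a b, a < x < b ->
    is_RInt (fun y => exp (-2 * Rabs (x - y)) * r y) a b (J x (a, b))).
  { intros x a b Hx. apply (is_RInt_Chasles (V := R_NormedModule) _ a x b
      (exp (-2 * x) * (al x - al a)) (exp (2 * x) * (be b - be x))).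
    - apply (is_RInt_ext (fun y => scal (exp (-2 * x)) (exp (2 * y) * r y))).
      + rewrite Rmin_left, Rmax_right by lra. intros y Hy.
        rewrite Rabs_pos_eq by lra. unfold scal; simpl; unfold mult; simpl.
        rewrite <- Rmult_assoc, <- exp_plus. do 2 f_equal. ring.
      + apply (is_RInt_scal (V := R_NormedModule)).
        apply is_RInt_continuous_primitive; auto.
    - apply (is_RInt_ext (fun y => scal (exp (2 * x)) (exp (-2 * y) * r y))).
      + rewrite Rmin_left, Rmax_right by lra. intros y Hy.
        rewrite Rabs_left by lra. unfold scal; simpl; unfold mult; simpl.
        rewrite <- Rmult_assoc, <- exp_plus. do 2 f_equal. ring.
      + apply (is_RInt_scal (V := R_NormedModule)).
        apply is_RInt_continuous_primitive; auto. }
  set (FF := filter_prod (Rbar_locally m_infty) (Rbar_locally p_infty)).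
  assert (HJ : forall x, filterlim (J x) FF (locally (I x))).
  { intros x P HP. generalize (HI x P HP). unfold filtermapi, filtermap.
    intros HQ.
    (* The closed form holds only for a < x < b, which is eventually true along the filter. *)
    assert (Hx : FF (fun t => fst t < x < snd t)).
    { exists (fun a => a < x) (fun b => x < b); simpl; try easy; now exists x. }
    generalize (filter_and _ _ HQ Hx). apply filter_imp.
    intros [a b] [[y [Hy HPy]] Hab]; simpl in *.
    rewrite <- (is_RInt_unique _ _ _ _ (Hint x a b Hab)).
    now rewrite (is_RInt_unique _ _ _ _ Hy). }
  set (e := exp 2). set (e' := exp (-2)).
  assert (Hee : e' < e) by (apply exp_increasing; lra).
  (* [J 0] and [J 1] are affine in [al (fst t)] and [be (snd t)] with nonzero determinant, because
     exp(-2) < exp 2. The coefficients passed to [lin] solve this system for each endpoint. *)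
  assert (HL : exists la lb,
    filterlim al (Rbar_locally m_infty) (locally la)
    /\ filterlim be (Rbar_locally p_infty) (locally lb)).
  { assert (lin : forall p q s, filterlim (fun t => p * J 0 t + q * J 1 t + s) FF
       (locally (p * I 0 + q * I 1 + s))).
    { intros p q s.
      eapply (filterlim_comp_2 (G := locally (p * I 0 + q * I 1)) (H := locally s)
        (fun t => p * J 0 t + q * J 1 t) (fun _ => s) Rplus).
      - eapply (filterlim_comp_2 (fun t => p * J 0 t) (fun t => q * J 1 t) Rplus).
        + eapply filterlim_comp; [apply HJ | apply (filterlim_scal_r p (I 0))].
        + eapply filterlim_comp; [apply HJ | apply (filterlim_scal_r q (I 1))].
        + apply (filterlim_plus (p * I 0) (q * I 1)).
      - apply filterlim_const.
      - apply (filterlim_plus (p * I 0 + q * I 1) s). }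
    do 2 eexists. split.
    - apply (filterlim_prod_fst (Rbar_locally m_infty) (Rbar_locally p_infty) al).
      eapply filterlim_ext;
        [|apply (lin (/ (e' - e) * e) (- / (e' - e))
             (/ (e' - e) * (- e * al 0 + e * be 0 + e' * al 1 - e * be 1)))].
      intros [a b]; unfold J; simpl fst; simpl snd.
      rewrite !Rmult_0_r, !Rmult_1_r, exp_0. fold e e'. field. lra.
    - apply (filterlim_prod_snd (Rbar_locally m_infty) (Rbar_locally p_infty) be).
      eapply filterlim_ext;
        [|apply (lin (- / (e - e') * e') (/ (e - e'))
             (/ (e - e') * (- e' * al 1 + e * be 1 + e' * al 0 - e' * be 0)))].
      intros [a b]; unfold J; simpl fst; simpl snd.
      rewrite !Rmult_0_r, !Rmult_1_r, exp_0. fold e e'. field. lra. }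
  destruct HL as [la [lb [Hla Hlb]]].
  assert (Hexp : forall c x, exp (c * x) * exp (- c * x) = 1).
  { intros c x. rewrite <- exp_plus, <- exp_0. f_equal. ring. }
  (* The integrals of the kernel against [r] over y < x and over y > x. *)
  exists (fun x => exp (-2 * x) * (al x - la)), (fun x => exp (2 * x) * (lb - be x)).
  split; [|split; [|split; [|split]]].
  - intros x. apply (filterlim_locally_unique (F := FF) (J x) (I x) _ (HJ x)).
    unfold J.
    eapply (filterlim_comp_2 (fun t => exp (-2 * x) * (al x - al (fst t)))
       (fun t => exp (2 * x) * (be (snd t) - be x)) Rplus);
     [| |apply (filterlim_plus (exp (-2 * x) * (al x - la)) (exp (2 * x) * (lb - be x)))].
    + eapply (filterlim_comp _ _ _ (fun t => al (fst t)) (fun a => exp (-2 * x) * (al x - a)));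
       [apply (filterlim_comp _ _ _ fst al _ (Rbar_locally m_infty)); [apply filterlim_fst | apply Hla]|].
      apply (ex_derive_continuous (fun a => exp (-2 * x) * (al x - a))).
      auto_derive; easy.
    + eapply (filterlim_comp _ _ _ (fun t => be (snd t)) (fun b => exp (2 * x) * (b - be x)));
       [apply (filterlim_comp _ _ _ snd be _ (Rbar_locally p_infty)); [apply filterlim_snd | apply Hlb]|].
      apply (ex_derive_continuous (fun b => exp (2 * x) * (b - be x))).
      auto_derive; easy.
  - intros x. eapply is_derive_eq.
    + apply Derive.is_derive_mult.
      * auto_derive; [easy | reflexivity].
      * apply @is_derive_minus; [apply Hal | apply @is_derive_const].
    + unfold minus, plus, opp, zero; simpl.
      replace (r x) with (exp (2 * x) * exp (- (2) * x) * r x) at 2 by (rewrite Hexp; ring).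
      replace (- (2)) with (-2) by lra. ring.
  - intros x. eapply is_derive_eq.
    + apply Derive.is_derive_mult.
      * auto_derive; [easy | reflexivity].
      * apply @is_derive_minus; [apply @is_derive_const | apply Hbe].
    + unfold minus, plus, opp, zero; simpl.
      replace (r x) with (exp (2 * x) * exp (- (2) * x) * r x) at 2 by (rewrite Hexp; ring).
      replace (- (2)) with (-2) by lra. ring.
  - apply (filterlim_ext (fun x => al x - la)).
    + intros x. rewrite <- Rmult_assoc.
      replace (-2) with (- (2)) by lra. rewrite Hexp. ring.
    + replace (locally 0) with (locally (la - la)) by (f_equal; ring).
      eapply (filterlim_comp _ _ _ al (fun a => a - la)); [apply Hla|].
      apply (ex_derive_continuous (fun a => a - la)). auto_derive; easy.
  - apply (filterlim_ext (fun x => lb - be x)).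
    + intros x. rewrite <- Rmult_assoc, (Rmult_comm (exp (-2 * x))).
      replace (-2) with (- (2)) by lra. rewrite Hexp. ring.
    + replace (locally 0) with (locally (lb - lb)) by (f_equal; ring).
      eapply (filterlim_comp _ _ _ be (fun a => lb - a)); [apply Hlb|].
      apply (ex_derive_continuous (fun a => lb - a)). auto_derive; easy.
Qed.

(** * Growth of solutions of linear first-order equations *)

(** A smooth substitute for exp(d|x|), comparable to it up to a factor of 2. *)
Definition wgt (d x : R) : R := exp (d * x) + exp (- d * x).

Definition dominated (d : R) (v : R -> R) : Prop :=
  exists K, 0 <= K /\ forall x, Rabs (v x) <= K * wgt d x.

Lemma wgt_ge1 (d x : R) : 1 <= wgt d x.
Proof.
  unfold wgt. generalize (exp_ineq1_le (d * x)) (exp_ineq1_le (- d * x)). lra.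
Qed.

Lemma wgt_opp (d x : R) : wgt d (- x) = wgt d x.
Proof.
  unfold wgt. rewrite Rplus_comm. f_equal; f_equal; ring.
Qed.

Lemma dominated_ext (d : R) (v w : R -> R) :
  (forall x, v x = w x) -> dominated d v -> dominated d w.
Proof.
  intros He [K [HK H]]. exists K. split; [easy|]. intros x. now rewrite <- He.
Qed.

Lemma dominated_bounded (d : R) (v : R -> R) (M : R) :
  (forall x, Rabs (v x) <= M) -> dominated d v.
Proof.
  intros H. exists (Rmax 0 M). split; [apply Rmax_l|].
  intros x. generalize (wgt_ge1 d x) (H x) (Rmax_r 0 M) (Rmax_l 0 M). nra.
Qed.

Lemma dominated_plus (d : R) (v w : R -> R) :
  dominated d v -> dominated d w -> dominated d (fun x => v x + w x).
Proof.
  intros [K [HK H]] [L [HL H']]. exists (K + L). split; [lra|].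
  intros x. generalize (H x) (H' x) (Rabs_triang (v x) (w x)). lra.
Qed.

Lemma dominated_mult_bounded (d : R) (b v : R -> R) (M : R) :
  (forall x, Rabs (b x) <= M) -> dominated d v -> dominated d (fun x => b x * v x).
Proof.
  intros Hb [K [HK H]].
  assert (HM : 0 <= M) by (generalize (Hb 0) (Rabs_pos (b 0)); lra).
  exists (M * K). split; [nra|]. intros x. rewrite Rabs_mult, Rmult_assoc.
  apply Rmult_le_compat; auto using Rabs_pos.
Qed.

Lemma dominated_scal (d c : R) (v : R -> R) :
  dominated d v -> dominated d (fun x => c * v x).
Proof.
  apply (dominated_mult_bounded d (fun _ => c) v (Rabs c)).
  intros; lra.
Qed.

Lemma dominated_sum (d : R) (a : nat -> R -> R) (N : nat) :
  (forall k, (k <= N)%nat -> dominated d (a k)) ->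
  dominated d (fun x => sum_f_R0 (fun k => a k x) N).
Proof.
  induction N as [|N IH]; intros H; simpl; [apply H; lia|].
  apply dominated_plus; [apply IH; intros; apply H; lia | apply H; lia].
Qed.

Lemma dominated_primitive (d : R) (v dv : R -> R) :
  0 < d -> (forall x, is_derive v x (dv x)) -> dominated d dv -> dominated d v.
Proof.
  intros Hd Hv [K [HK H]].
  assert (HKd : 0 <= K / d) by (apply Rdiv_le_0_compat; lra).
  exists (Rabs (v 0) + K / d). split; [generalize (Rabs_pos (v 0)); lra|].
  (* Comparison function with derivative [K * wgt d x], so that S + v and S - v are both
     nondecreasing. *)
  set (S := fun x => K / d * (exp (d * x) - exp (- d * x))).
  assert (HS : forall x, is_derive S x (K * wgt d x)).
  { intros x. unfold S, wgt. auto_derive; [easy|]. field. lra. }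
  assert (Hmono : forall c a b, Rabs c = 1 -> a <= b -> S a + c * v a <= S b + c * v b).
  { intros c a b Hc Hab.
    apply (nondecreasing_of_derive_ge0 (fun x => S x + c * v x)
             (fun x => K * wgt d x + c * dv x)); [easy| |].
    - intros x _. apply @is_derive_plus; [apply HS | apply is_derive_scal, Hv].
    - intros x _. generalize (H x) (Rle_abs (- (c * dv x))).
      rewrite Rabs_Ropp, Rabs_mult, Hc. lra. }
  assert (Hc1 : Rabs 1 = 1) by apply Rabs_R1.
  assert (Hc2 : Rabs (-1) = 1) by (rewrite Rabs_left; lra).
  assert (HS0 : S 0 = 0).
  { unfold S. rewrite !Rmult_0_r. ring. }
  intros x.
  assert (HSx : Rabs (S x) <= K / d * wgt d x).
  { unfold S, wgt. generalize (exp_pos (d * x)) (exp_pos (- d * x)); intros e1 e2.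
    apply Rabs_le. split; nra. }
  generalize (wgt_ge1 d x) (Rabs_pos (v 0)); intros W V0.
  assert (Hx : Rabs (v x - v 0) <= Rabs (S x)).
  { destruct (Rle_dec 0 x) as [Hx|Hx].
    - generalize (Hmono 1 0 x Hc1 Hx) (Hmono (-1) 0 x Hc2 Hx) (Rle_abs (S x)).
      rewrite HS0. intros. apply Rabs_le. lra.
    - assert (Hx' : x <= 0) by lra.
      generalize (Hmono 1 x 0 Hc1 Hx') (Hmono (-1) x 0 Hc2 Hx') (Rle_abs (- S x)).
      rewrite HS0, Rabs_Ropp. intros. apply Rabs_le. lra. }
  generalize (Rabs_triang (v x - v 0) (v 0)).
  replace (v x - v 0 + v 0) with (v x) by ring. nra.
Qed.

(* Writing the forcing term as dp + s avoids any bound on the derivative dp. *)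
Lemma dominated_stable_ode (d : R) (U p dp s : R -> R) :
  0 < d <= 1 ->
  (forall x, is_derive p x (dp x)) ->
  (forall x, is_derive U x (-2 * U x + (dp x + s x))) ->
  dominated d p -> dominated d s ->
  filterlim (fun x => exp (2 * x) * U x) (Rbar_locally m_infty) (locally 0) ->
  dominated d U.
Proof.
  intros Hd Hp HU [K1 [HK1 H1]] [K2 [HK2 H2]] Hlim.
  set (K := K1 + K2).
  assert (Hps : forall x, Rabs (p x) <= K * wgt d x /\ Rabs (s x) <= K * wgt d x).
  { intros x. generalize (H1 x) (H2 x) (wgt_ge1 d x). unfold K. split; nra. }
  assert (HK : 0 <= K) by (unfold K; lra).
  (* Integrating factor applied to U - p: the derivative of [D] contains s - 2p and no longer
     [dp]. *)
  set (D := fun x => exp (2 * x) * (U x - p x)).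
  set (P := fun x => exp (2 * x) * wgt d x).
  assert (HD : forall x, is_derive D x (exp (2 * x) * (s x - 2 * p x))).
  { intros x. eapply is_derive_eq.
    - apply Derive.is_derive_mult; [auto_derive; [easy | reflexivity]|].
      apply @is_derive_minus; [apply HU | apply Hp].
    - unfold minus, plus, opp; simpl. ring. }
  assert (HP : forall x, is_derive P x
    (exp (2 * x) * (2 * wgt d x + d * (exp (d * x) - exp (- d * x))))).
  { intros x. unfold P, wgt. auto_derive; [easy|]. ring. }
  (* Here [d <= 1] enters: the barrier [P] has derivative at least [P], while the derivative of [D]
     is at most 3K P in absolute value. *)
  assert (HPp : forall x, exp (2 * x) * wgt d x <=
    exp (2 * x) * (2 * wgt d x + d * (exp (d * x) - exp (- d * x)))).
  { intros x. apply Rmult_le_compat_l; [left; apply exp_pos|].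
    unfold wgt. generalize (exp_pos (d * x)) (exp_pos (- d * x)). nra. }
  assert (Hc : forall c x, Rabs c = 1 -> 0 <= 3 * K * P x + c * D x).
  { intros c x Hc. apply Rnot_lt_le. intros Hneg.
    set (e := - (3 * K * P x + c * D x)).
    assert (He : 0 < e) by (unfold e; lra).
    (* Far to the left exp(2x) U is smaller than [e], and 3K P absorbs the [p] part of [D];
       monotonicity carries this lower bound to [x], a contradiction. *)
    destruct (Hlim _ (locally_ball 0 (mkposreal e He))) as [M HM].
    set (x0 := Rmin (M - 1) x).
    assert (Hx0 : x0 < M) by (unfold x0; generalize (Rmin_l (M - 1) x); lra).
    assert (Hx0' : x0 <= x) by apply Rmin_r.
    specialize (HM x0 Hx0). unfold ball in HM; simpl in HM.
    unfold AbsRing_ball, abs, minus, plus, opp in HM; simpl in HM.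
    rewrite Ropp_0, Rplus_0_r in HM.
    assert (Hm : 3 * K * P x0 + c * D x0 <= 3 * K * P x + c * D x).
    { apply (nondecreasing_of_derive_ge0 (fun t => 3 * K * P t + c * D t)
        (fun t => 3 * K * (exp (2 * t) * (2 * wgt d t + d * (exp (d * t) - exp (- d * t))))
           + c * (exp (2 * t) * (s t - 2 * p t)))); [easy| |].
      - intros t _. apply @is_derive_plus; apply is_derive_scal; auto.
      - intros t _.
        assert (Rabs (c * (exp (2 * t) * (s t - 2 * p t))) <= 3 * K * (exp (2 * t) * wgt d t)).
        { rewrite !Rabs_mult, Hc, (Rabs_pos_eq (exp _)) by (left; apply exp_pos).
          destruct (Hps t) as [A B].
          assert (Rabs (s t - 2 * p t) <= 3 * (K * wgt d t)).
          { replace (s t - 2 * p t) with (s t + (- 2) * p t) by ring.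
            eapply Rle_trans; [apply Rabs_triang|].
            rewrite Rabs_mult, (Rabs_left (-2)) by lra. lra. }
          generalize (exp_pos (2 * t)). nra. }
        generalize (Rle_abs (- (c * (exp (2 * t) * (s t - 2 * p t))))).
        rewrite Rabs_Ropp. generalize (HPp t). nra. }
    assert (Hl : - e < 3 * K * P x0 + c * D x0).
    { unfold D, P.
      replace (3 * K * (exp (2 * x0) * wgt d x0) + c * (exp (2 * x0) * (U x0 - p x0)))
       with (exp (2 * x0) * (3 * (K * wgt d x0) - c * p x0) + c * (exp (2 * x0) * U x0))
       by ring.
      assert (0 <= 3 * (K * wgt d x0) - c * p x0).
      { destruct (Hps x0) as [A _]. generalize (Rle_abs (c * p x0)).
        rewrite Rabs_mult, Hc. generalize (Rabs_pos (p x0)). lra. }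
      generalize (Rle_abs (- (c * (exp (2 * x0) * U x0)))).
      rewrite Rabs_Ropp, Rabs_mult, Hc.
      generalize (exp_pos (2 * x0)). nra. }
    unfold e in Hl; lra. }
  exists (4 * K). split; [lra|]. intros x.
  assert (Hc1 : Rabs 1 = 1) by apply Rabs_R1.
  assert (Hc2 : Rabs (-1) = 1) by (rewrite Rabs_left; lra).
  generalize (Hc 1 x Hc1) (Hc (-1) x Hc2). unfold D, P. intros A B.
  assert (Rabs (U x - p x) <= 3 * K * wgt d x).
  { generalize (exp_pos (2 * x)). intros e0. apply Rabs_le.
    split; apply (Rmult_le_reg_l (exp (2 * x))); auto; lra. }
  generalize (Rabs_triang (U x - p x) (p x)).
  replace (U x - p x + p x) with (U x) by ring.
  destruct (Hps x); lra.
Qed.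

Lemma dominated_opp_arg (d : R) (v : R -> R) :
  dominated d v -> dominated d (fun x => v (- x)).
Proof.
  intros [K [HK H]]. exists K. split; [easy|]. intros x. rewrite <- wgt_opp. apply H.
Qed.

Lemma is_derive_opp_arg (v : R -> R) (x d : R) :
  is_derive v (- x) d -> is_derive (fun t => v (- t)) x (- d).
Proof.
  intros H. eapply is_derive_eq.
  - apply (is_derive_comp v Ropp); [apply H|].
    apply (is_derive_opp (fun t : R => t)), is_derive_id.
  - unfold scal, opp, one; simpl; unfold mult; simpl. ring.
Qed.

(** The reflection x -> -x reduces this to the stable case. *)
Lemma dominated_unstable_ode (d : R) (V p dp s : R -> R) :
  0 < d <= 1 ->
  (forall x, is_derive p x (dp x)) ->
  (forall x, is_derive V x (2 * V x - (dp x + s x))) ->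
  dominated d p -> dominated d s ->
  filterlim (fun x => exp (-2 * x) * V x) (Rbar_locally p_infty) (locally 0) ->
  dominated d V.
Proof.
  intros Hd Hp HV Dp Ds Hlim.
  apply (dominated_ext d (fun x => V (- - x))); [intros x; f_equal; ring|].
  apply (dominated_opp_arg d (fun x => V (- x))).
  apply (dominated_stable_ode d _ (fun x => -1 * p (- x)) (fun x => dp (- x))
           (fun x => s (- x))); [easy| | | | |].
  - intros x. eapply is_derive_eq;
      [apply is_derive_scal, is_derive_opp_arg, Hp | ring].
  - intros x. eapply is_derive_eq; [apply is_derive_opp_arg, HV | ring].
  - apply dominated_scal. now apply (dominated_opp_arg d p).
  - now apply (dominated_opp_arg d s).
  - eapply filterlim_ext;
      [|apply (filterlim_comp _ _ _ Ropp (fun x => exp (-2 * x) * V x)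
         (Rbar_locally m_infty) (Rbar_locally p_infty)); [|apply Hlim]].
    + intros x. simpl. f_equal. f_equal. ring.
    + apply (filterlim_Rbar_opp m_infty).
Qed.

(** * The recursion coefficients *)

Definition wfun (u : R -> R) (x : R) : R := 4 * u x - dx2 u x.

(** All small rates [d] are required because the energy estimate has a constant depending on z. The
    second derivative is included since it enters [g_x] and [h]. *)
Definition tame (v : R -> R) : Prop :=
  (forall k, diffn k v)
  /\ forall d, 0 < d <= 1 ->
     dominated d v /\ dominated d (Derive v) /\ dominated d (Derive (Derive v)).

Lemma wfun_is_derive (u : R -> R) (x : R) :
  smooth u -> is_derive (wfun u) x (4 * dx1 u x - dx3 u x).
Proof.
  intros Hu. apply @is_derive_minus.
  - apply is_derive_scal, Derive_correct, (Hu 0%nat).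
  - apply (Derive_correct (Derive_n u 2)), (Hu 2%nat).
Qed.

Lemma wfun_diffn (u : R -> R) : smooth u -> forall k, diffn k (wfun u).
Proof.
  intros Hu k. apply diffn_minus; [apply diffn_scal; now apply diffn_of_smooth|].
  apply diffn_of_smooth. intros j x.
  apply (ex_derive_ext (Derive_n u (j + 2))); [|apply Hu].
  intros t. symmetry. apply Derive_n_comp.
Qed.

Lemma wfun_bounded (u : R -> R) :
  (forall k : nat, (k <= 2)%nat -> exists M : R, forall x : R, Rabs (Derive_n u k x) <= M) ->
  exists M, forall x, Rabs (wfun u x) <= M.
Proof.
  intros Hb. destruct (Hb 0%nat) as [M0 H0]; [lia|]. destruct (Hb 2%nat) as [M2 H2]; [lia|].
  exists (4 * M0 + M2). intros x. unfold wfun, dx2.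
  generalize (Rabs_triang (4 * u x) (- Derive_n u 2 x)) (H0 x) (H2 x).
  rewrite Rabs_Ropp, Rabs_mult, (Rabs_pos_eq 4) by lra. simpl. unfold Rminus. lra.
Qed.

(** With [U], [V] from [green_split] the first derivative of f_{l+1} is -(U + V)/2 and the second is
    U - V; the first-order equations of [U] and [V] then give the third, without differentiating
    under the integral. *)
Lemma tame_step (u : R -> R) (f : nat -> R -> R) (l : nat) (M : R) :
  smooth u -> (forall x, Rabs (wfun u x) <= M) ->
  (forall x, exists I : R,
     is_RInt_gen (fun y => exp (-2 * Rabs (x - y)) * rec_rhs u f (S l) y)
       (Rbar_locally m_infty) (Rbar_locally p_infty) I
     /\ is_derive (f (S l)) x (-2 * (/ 4 * I))) ->
  tame (f l) ->
  tame (f (S l))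
  /\ forall x, is_derive (Derive (Derive (f (S l)))) x
       (4 * Derive (f (S l)) x + 2 * rec_rhs u f (S l) x).
Proof.
  intros Hu HM Hrec [Sf Df].
  assert (Hf : forall x, is_derive (f l) x (Derive (f l) x)).
  { intros x. apply Derive_correct. destruct (Sf 1%nat) as [v' [Hv _]]. now exists (v' x). }
  set (r := rec_rhs u f (S l)).
  set (dw := fun x => 4 * dx1 u x - dx3 u x).
  (* The source w_x f + 2 w f_x is split as (w f)_x + w f_x, which confines u_xxx to a total
     derivative. *)
  set (dp := fun x => dw x * f l x + wfun u x * Derive (f l) x).
  set (s := fun x => wfun u x * Derive (f l) x).
  assert (Hr : forall x, r x = dp x + s x).
  { intros x. unfold r, rec_rhs, dp, s, dw, wfun.
    replace (S l - 1)%nat with l by lia. ring. }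
  assert (Sdf : forall k, diffn k (Derive (f l))) by now apply (diffn_deriv (f l)).
  assert (Sw : forall k, diffn k (wfun u)) by now apply wfun_diffn.
  assert (Sr : forall k, diffn k r).
  { intros k. apply (diffn_ext k (fun x => dp x + s x)); [now intros; rewrite Hr|].
    apply diffn_plus; [apply diffn_plus|]; apply diffn_mult; auto.
    apply (diffn_deriv (wfun u)); [|easy]. intros x. now apply wfun_is_derive. }
  set (I := fun x => -2 * Derive (f (S l)) x).
  assert (Hder : forall x, ex_derive (f (S l)) x).
  { intros x. destruct (Hrec x) as [J [_ HJ]]. eexists; apply HJ. }
  assert (HI : forall x, is_RInt_gen (fun y => exp (-2 * Rabs (x - y)) * r y)
       (Rbar_locally m_infty) (Rbar_locally p_infty) (I x)).
  { intros x. destruct (Hrec x) as [J [HJ HdJ]]. unfold I.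
    rewrite (is_derive_unique _ _ _ HdJ). now replace (-2 * (-2 * (/ 4 * J))) with J by field. }
  destruct (green_split r I) as [U [V [HUV [HU [HV [LU LV]]]]]]; [|easy|].
  { apply diffn_continuous, Sr. }
  assert (Sdt : forall k, diffn k U /\ diffn k V).
  { intros k; split.
    - now apply (diffn_linear_ode (-2) U r).
    - apply (diffn_linear_ode 2 V (fun x => -1 * r x)).
      + intros x. eapply is_derive_eq; [apply HV | ring].
      + intros j. now apply diffn_scal. }
  assert (D1 : forall x, Derive (f (S l)) x = - / 2 * (U x + V x)).
  { intros x. rewrite <- HUV. unfold I. field. }
  assert (D2 : forall x, is_derive (Derive (f (S l))) x (U x - V x)).
  { intros x. apply (is_derive_ext (fun t => - / 2 * (U t + V t))).
    - intros t. now rewrite D1.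
    - eapply is_derive_eq;
        [apply is_derive_scal, @is_derive_plus; [apply HU | apply HV]|].
      unfold plus; simpl. field. }
  assert (D2' : forall x, Derive (Derive (f (S l))) x = U x - V x).
  { intros x. apply is_derive_unique, D2. }
  split; [split|].
  - intros [|k]; [easy|]. exists (Derive (f (S l))). split.
    + intros x. apply Derive_correct, Hder.
    + apply (diffn_ext k (fun t => - / 2 * (U t + V t))); [intros; now rewrite D1|].
      apply diffn_scal, diffn_plus; apply Sdt.
  - intros d Hd. destruct (Df d Hd) as [Df0 [Df1 _]].
    assert (Hp : forall x, is_derive (fun t => wfun u t * f l t) x (dp x)).
    { intros x. apply Derive.is_derive_mult; [now apply wfun_is_derive | apply Hf]. }
    assert (DU : dominated d U).
    { apply (dominated_stable_ode d U (fun t => wfun u t * f l t) dp s); auto.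
      - intros x. rewrite <- Hr. apply HU.
      - now apply (dominated_mult_bounded d _ _ M).
      - now apply (dominated_mult_bounded d _ _ M). }
    assert (DV : dominated d V).
    { apply (dominated_unstable_ode d V (fun t => wfun u t * f l t) dp s); auto.
      - intros x. rewrite <- Hr. apply HV.
      - now apply (dominated_mult_bounded d _ _ M).
      - now apply (dominated_mult_bounded d _ _ M). }
    assert (Dd : dominated d (Derive (f (S l)))).
    { apply (dominated_ext d (fun t => - / 2 * (U t + V t))); [now intros; rewrite D1|].
      now apply dominated_scal, dominated_plus. }
    split; [|split; [easy|]].
    + apply (dominated_primitive d _ (Derive (f (S l)))); [easy| |easy].
      intros x. apply Derive_correct, Hder.
    + apply (dominated_ext d (fun t => U t + -1 * V t)); [intros; rewrite D2'; ring|].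
      now apply dominated_plus, dominated_scal.
  - intros x. apply (is_derive_ext (fun t => U t - V t)); [now intros; rewrite D2'|].
    eapply is_derive_eq; [apply @is_derive_minus; [apply HU | apply HV]|].
    unfold minus, plus, opp; simpl. rewrite D1. fold r. field.
Qed.

Lemma tame_one (v : R -> R) : (forall x, v x = 1) -> tame v.
Proof.
  intros Hv.
  assert (D1 : forall x, Derive v x = 0).
  { intros x. apply is_derive_unique, (is_derive_ext (fun _ => 1)); [easy|].
    apply @is_derive_const. }
  assert (D2 : forall x, Derive (Derive v) x = 0).
  { intros x. apply is_derive_unique, (is_derive_ext (fun _ => 0)); [easy|].
    apply @is_derive_const. }
  split.
  - intros k. apply (diffn_ext k (fun _ => 1)); [easy | apply diffn_const].
  - intros d _. split; [|split].
    + apply (dominated_bounded d v 1). intros x. rewrite Hv, Rabs_R1. lra.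
    + apply (dominated_bounded d _ 0). intros x. rewrite D1, Rabs_R0. lra.
    + apply (dominated_bounded d _ 0). intros x. rewrite D2, Rabs_R0. lra.
Qed.

Lemma tame_recursion (n : nat) (u : R -> R) (f : nat -> R -> R) :
  smooth u ->
  (forall k : nat, (k <= 2)%nat -> exists M : R, forall x : R, Rabs (Derive_n u k x) <= M) ->
  (forall x, f O x = 1) ->
  (forall (l : nat) (x : R), (1 <= l <= n)%nat ->
     exists I : R,
       is_RInt_gen (fun y => exp (-2 * Rabs (x - y)) * rec_rhs u f l y)
         (Rbar_locally m_infty) (Rbar_locally p_infty) I
       /\ is_derive (f l) x (-2 * (/ 4 * I))) ->
  (forall l, (l <= n)%nat -> tame (f l))
  /\ (forall l x, (S l <= n)%nat -> is_derive (Derive (Derive (f (S l)))) x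
       (4 * Derive (f (S l)) x + 2 * rec_rhs u f (S l) x)).
Proof.
  intros Hu Hb H0 Hrec. destruct (wfun_bounded u Hb) as [M HM].
  assert (Ht : forall l, (l <= n)%nat -> tame (f l)).
  { induction l as [|l IH]; intros Hl; [now apply tame_one|].
    apply (tame_step u f l M); auto; [|apply IH; lia].
    intros x. apply Hrec. lia. }
  split; [easy|]. intros l x Hl.
  apply (tame_step u f l M); auto; [|apply Ht; lia].
  intros y. apply Hrec. lia.
Qed.

(* f, g, h are the coefficients of F_n, G_n, H_n; the last four fields read
   F_x = 2G - 2F, zG_x = wF - H, H_x = 2H - 2wG coefficientwise. *)
Record zero_curvature (n : nat) (w : R -> R) (f g h dg : nat -> R -> R) : Prop := {
  zc_dg0 : forall x, dg O x = 0;
  zc_smooth_g : forall l, (l <= n)%nat -> forall k, diffn k (g l);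
  zc_dom : forall l d, (l <= n)%nat -> 0 < d <= 1 ->
     dominated d (f l) /\ dominated d (g l) /\ dominated d (h l);
  zc_dg : forall l x, (l <= n)%nat -> is_derive (g l) x (dg l x);
  zc_f : forall l x, (l <= n)%nat -> is_derive (f l) x (2 * g l x - 2 * f l x);
  zc_g : forall l x, (S l <= n)%nat -> dg (S l) x = w x * f l x - h l x;
  zc_gn : forall x, h n x = w x * f n x;
  zc_h : forall l x, (l <= n)%nat -> is_derive (h l) x (2 * h l x - 2 * w x * g l x)
}.

(** For l < n the law of [h] rests on the third-order equation of f_{l+1}; for l = n, where [h] has
    no [g] term, it is the stationary equation. *)
Lemma zero_curvature_CH (n : nat) (u : R -> R) (f : nat -> R -> R) :
  smooth u ->
  (forall k : nat, (k <= 2)%nat -> exists M : R, forall x : R, Rabs (Derive_n u k x) <= M) ->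
  (forall x, f O x = 1) ->
  (forall (l : nat) (x : R), (1 <= l <= n)%nat ->
     exists I : R,
       is_RInt_gen (fun y => exp (-2 * Rabs (x - y)) * rec_rhs u f l y)
         (Rbar_locally m_infty) (Rbar_locally p_infty) I
       /\ is_derive (f l) x (-2 * (/ 4 * I))) ->
  (forall x, sCH n u f x = 0) ->
  zero_curvature n (wfun u) f (gfun f) (hfun n u f) (fun l => Derive (gfun f l)).
Proof.
  intros Hu Hb H0 Hrec HCH.
  destruct (tame_recursion n u f Hu Hb H0 Hrec) as [Ht Hr].
  destruct (wfun_bounded u Hb) as [M HM].
  assert (Sf : forall l, (l <= n)%nat -> forall k, diffn k (f l)) by (intros; now apply Ht).
  assert (D1 : forall l x, (l <= n)%nat -> is_derive (f l) x (Derive (f l) x)).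
  { intros l x Hl. apply Derive_correct. destruct (Sf l Hl 1%nat) as [v' [Hv _]]. now exists (v' x). }
  assert (Sdf : forall l, (l <= n)%nat -> forall k, diffn k (Derive (f l))).
  { intros l Hl. apply (diffn_deriv (f l)); auto. }
  assert (D2 : forall l x, (l <= n)%nat ->
     is_derive (Derive (f l)) x (Derive (Derive (f l)) x)).
  { intros l x Hl. apply Derive_correct.
    destruct (Sdf l Hl 1%nat) as [v' [Hv _]]. now exists (v' x). }
  assert (Dg : forall l x, (l <= n)%nat ->
     is_derive (gfun f l) x (Derive (f l) x + / 2 * Derive (Derive (f l)) x)).
  { intros l x Hl. apply @is_derive_plus; [now apply D1 | now apply is_derive_scal, D2]. }
  assert (Sg : forall l, (l <= n)%nat -> forall k, diffn k (gfun f l)).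
  { intros l Hl k. apply diffn_plus; [now apply Sf|]. now apply diffn_scal, Sdf. }
  assert (Dgd : forall l d, (l <= n)%nat -> 0 < d <= 1 -> dominated d (Derive (gfun f l))).
  { intros l d Hl Hd. destruct (proj2 (Ht l Hl) d Hd) as [_ [A B]].
    apply (dominated_ext d (fun x => Derive (f l) x + / 2 * Derive (Derive (f l)) x)).
    - intros x. symmetry. now apply is_derive_unique, Dg.
    - now apply dominated_plus, dominated_scal. }
  constructor; auto.
  - intros x. apply is_derive_unique, (is_derive_ext (fun _ => 1));
      [|apply @is_derive_const].
    intros t. unfold gfun. rewrite H0.
    rewrite (is_derive_unique (f 0%nat) t 0); [change (1 = 1 + / 2 * 0); ring|].
    apply (is_derive_ext (fun _ => 1)); [easy | apply @is_derive_const].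
  - intros l d Hl Hd. destruct (proj2 (Ht l Hl) d Hd) as [A [B C]].
    split; [easy|]. split; [now apply dominated_plus, dominated_scal|].
    unfold hfun. destruct (Nat.ltb_spec l n).
    + apply (dominated_ext d (fun x => wfun u x * f l x + -1 * Derive (gfun f (S l)) x)).
      { intros; unfold wfun; ring. }
      apply dominated_plus; [now apply (dominated_mult_bounded d _ _ M)|].
      apply dominated_scal, Dgd; auto.
    + now apply (dominated_mult_bounded d (wfun u) _ M).
  - intros l x Hl. apply Derive_correct. eexists. now apply Dg.
  - intros l x Hl. eapply is_derive_eq; [now apply D1|]. unfold gfun. field.
  - intros l x Hl. unfold hfun. destruct (Nat.ltb_spec l n); [|lia]. unfold wfun. ring.
  - intros x. unfold hfun. now rewrite Nat.ltb_irrefl.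
  - intros l x Hl. destruct (Nat.eq_dec l n) as [->|Hn].
    + unfold hfun. rewrite Nat.ltb_irrefl.
      eapply is_derive_eq; [apply (Derive.is_derive_mult (wfun u) (f n));
        [now apply wfun_is_derive | now apply D1]|].
      generalize (HCH x). unfold sCH, gfun, wfun. lra.
    + assert (Hl' : (S l <= n)%nat) by lia.
      unfold hfun. destruct (Nat.ltb_spec l n); [|lia].
      apply (is_derive_ext (fun t => wfun u t * f l t -
        (Derive (f (S l)) t + / 2 * Derive (Derive (f (S l))) t))).
      { intros t. f_equal. symmetry. now apply is_derive_unique, Dg. }
      rewrite (is_derive_unique _ _ _ (Dg (S l) x Hl')).
      eapply is_derive_eq.
      * apply @is_derive_minus.
        -- apply Derive.is_derive_mult; [now apply wfun_is_derive | now apply D1].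
        -- apply @is_derive_plus; [now apply D2 | apply is_derive_scal; now apply Hr].
      * unfold minus, plus, opp; simpl. unfold rec_rhs, gfun, wfun.
        replace (S l - 1)%nat with l by lia. field.
Qed.

(** * Differential inequalities against slow growth *)

Lemma dominated_mult (d : R) (v w : R -> R) :
  dominated d v -> dominated d w -> dominated (2 * d) (fun x => v x * w x).
Proof.
  intros [K [HK H]] [L [HL H']]. exists (2 * (K * L)). split; [nra|].
  intros x. rewrite Rabs_mult.
  apply (Rle_trans _ ((K * wgt d x) * (L * wgt d x))).
  - apply Rmult_le_compat; auto using Rabs_pos.
  - assert (wgt d x * wgt d x <= 2 * wgt (2 * d) x).
    { unfold wgt. replace (2 * d * x) with (d * x + d * x) by ring.
      replace (- (2 * d) * x) with (- d * x + - d * x) by ring. rewrite !exp_plus.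
      generalize (Rle_0_sqr (exp (d * x) - exp (- d * x))). unfold Rsqr. lra. }
    assert (0 <= K * L) by nra. nra.
Qed.

Lemma derive_pos_locally (v : R -> R) (x dv : R) :
  is_derive v x dv -> 0 < dv ->
  exists del, 0 < del /\ (forall t, x < t < x + del -> v x < v t)
    /\ (forall t, x - del < t < x -> v t < v x).
Proof.
  intros Hd Hp.
  destruct (proj1 (is_derive_Reals _ _ _) Hd dv Hp) as [del Hdel].
  exists del. split; [apply cond_pos|].
  assert (Hq : forall t, t <> x -> Rabs (t - x) < del -> 0 < (v t - v x) / (t - x)).
  { intros t Ht Hb. generalize (Hdel (t - x) ltac:(lra) Hb).
    replace (x + (t - x)) with t by ring. intros Hs. apply Rabs_def2 in Hs. lra. }
  split; intros t Ht.
  - assert (0 < (v t - v x) / (t - x)) by (apply Hq; [|rewrite Rabs_pos_eq]; lra).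
    assert (v t - v x = (v t - v x) / (t - x) * (t - x)) by (field; lra). nra.
  - assert (0 < (v t - v x) / (t - x)) by (apply Hq; [|rewrite Rabs_left]; lra).
    assert (v t - v x = (v t - v x) / (t - x) * (t - x)) by (field; lra). nra.
Qed.

Lemma derive_neg_locally (v : R -> R) (x dv : R) :
  is_derive v x dv -> dv < 0 ->
  exists del, 0 < del /\ (forall t, x < t < x + del -> v t < v x)
    /\ (forall t, x - del < t < x -> v x < v t).
Proof.
  intros Hd Hn.
  destruct (derive_pos_locally (fun t => -1 * v t) x (-1 * dv)) as [del [Hdel [H1 H2]]].
  - now apply is_derive_scal.
  - lra.
  - exists del. split; [easy|].
    split; intros t Ht; [generalize (H1 t Ht) | generalize (H2 t Ht)]; lra.
Qed.

Lemma interior_max_derive (v : R -> R) (a b x dv : R) :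
  a < x < b -> is_derive v x dv -> (forall t, a < t < b -> v t <= v x) -> dv = 0.
Proof.
  intros Hx Hd Hm. destruct (Rtotal_order dv 0) as [Hn|[|Hp]]; [exfalso|easy|exfalso].
  - destruct (derive_neg_locally v x dv Hd Hn) as [del [Hdel [_ H]]].
    set (t := Rmax (x - del / 2) ((a + x) / 2)).
    assert (x - del < t < x /\ a < t).
    { unfold t. split; [split|].
      - eapply Rlt_le_trans; [|apply Rmax_l]. lra.
      - apply Rmax_lub_lt; lra.
      - eapply Rlt_le_trans; [|apply Rmax_r]. lra. }
    generalize (H t) (Hm t). lra.
  - destruct (derive_pos_locally v x dv Hd Hp) as [del [Hdel [H _]]].
    set (t := Rmin (x + del / 2) ((x + b) / 2)).
    assert (x < t < x + del /\ t < b).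
    { unfold t. split; [split|].
      - apply Rmin_glb_lt; lra.
      - eapply Rle_lt_trans; [apply Rmin_l|]. lra.
      - eapply Rle_lt_trans; [apply Rmin_r|]. lra. }
    generalize (H t) (Hm t). lra.
Qed.

(* Past a point with T > 0 and T' > 0, T cannot reach an interior maximum. *)
Lemma positive_growth (T T1 : R -> R) (c d x1 : R) :
  0 <= d < c ->
  (forall x, is_derive T x (T1 x)) ->
  (forall x, 0 < T x -> c * T x <= T1 x \/ T1 x <= - (c * T x)) ->
  dominated d T -> 0 < T x1 -> T1 x1 <= 0.
Proof.
  intros Hdc HT Hdi [K [HK Hdom]] Hx1. apply Rnot_lt_le. intros HT1.
  assert (Hgrow : forall x2, x1 < x2 -> T x1 <= T x2 /\ c * T x2 <= T1 x2).
  { intros x2 H12.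
    destruct (continuity_ab_maj T x1 x2) as [m [Hm Hmm]]; [lra| |].
    { intros t _. eapply is_derive_continuity_pt, HT. }
    assert (Hmp : 0 < T m) by (generalize (Hm x1); lra).
    (* The maximum is not at [x1], where T increases, nor inside, where T_x = 0 contradicts [Hdi].
       Being at [x2], it also excludes the decreasing alternative there. *)
    assert (E : m = x2).
    { destruct (Req_dec m x2) as [|N2]; [easy|]. exfalso.
      destruct (Req_dec m x1) as [->|N1].
      - destruct (derive_pos_locally T x1 _ (HT x1) HT1) as [del [Hdel [H _]]].
        set (t := Rmin (x1 + del / 2) x2).
        assert (Ht : x1 < t < x1 + del /\ t <= x2).
        { unfold t. split; [split|apply Rmin_r].
          - apply Rmin_glb_lt; lra.
          - eapply Rle_lt_trans; [apply Rmin_l|]. lra. }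
        generalize (H t) (Hm t). lra.
      - assert (Z : T1 m = 0).
        { apply (interior_max_derive T x1 x2 m); [lra | apply HT|].
          intros t Ht. apply Hm; lra. }
        destruct (Hdi m Hmp); rewrite Z in *; nra. }
    subst m. split; [apply Hm; lra|].
    destruct (Hdi x2 Hmp) as [|Hneg]; [easy|]. exfalso.
    destruct (derive_neg_locally T x2 _ (HT x2)) as [del [Hdel [_ H]]]; [nra|].
    set (t := Rmax (x2 - del / 2) x1).
    assert (Ht : x2 - del < t < x2 /\ x1 <= t).
    { unfold t. split; [split|apply Rmax_r].
      - eapply Rlt_le_trans; [|apply Rmax_l]. lra.
      - apply Rmax_lub_lt; lra. }
    generalize (H t) (Hm t). lra. }
  assert (Hexp : forall x2, x1 < x2 -> T x1 * exp (- c * x1) <= T x2 * exp (- c * x2)).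
  { intros x2 H12.
    apply (nondecreasing_of_derive_ge0 (fun t => T t * exp (- c * t))
      (fun t => (T1 t - c * T t) * exp (- c * t))); [lra| |].
    - intros t _. eapply is_derive_eq.
      + apply Derive.is_derive_mult; [apply HT | auto_derive; [easy | reflexivity]].
      + simpl. ring.
    - intros t Ht. apply Rmult_le_pos; [|left; apply exp_pos].
      destruct (Req_dec t x1) as [->|]; [|generalize (Hgrow t); lra].
      destruct (Hdi x1 Hx1); [lra | nra]. }
  set (B := T x1 * exp (- c * x1)).
  assert (HB : 0 < B) by (apply Rmult_lt_0_compat; [easy | apply exp_pos]).
  (* Large enough that exp((c-d) x2) >= 1 + (c-d) x2 exceeds 2K/B; being nonnegative it also gives
     the bound of [wgt] by a single exponential. *)
  set (x2 := Rmax (Rmax 0 (x1 + 1)) (2 * K / B / (c - d))).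
  assert (G1 : 0 <= x2 /\ x1 + 1 <= x2 /\ 2 * K / B / (c - d) <= x2).
  { unfold x2. generalize (Rmax_l (Rmax 0 (x1 + 1)) (2 * K / B / (c - d)))
     (Rmax_r (Rmax 0 (x1 + 1)) (2 * K / B / (c - d))) (Rmax_l 0 (x1 + 1)) (Rmax_r 0 (x1 + 1)). lra. }
  destruct G1 as [G1 [G2 G3]].
  generalize (Hexp x2 ltac:(lra)). fold B. intros HBB.
  generalize (Hdom x2) (Rle_abs (T x2)). intros A1 A2.
  assert (Hw : wgt d x2 <= 2 * exp (d * x2)).
  { unfold wgt.
    assert (exp (- d * x2) <= exp (d * x2)).
    { destruct (Rle_lt_or_eq_dec (- d * x2) (d * x2)) as [Q|Q]; [nra| |].
      - left. now apply exp_increasing.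
      - rewrite Q. lra. }
    lra. }
  assert (HT2 : T x2 <= 2 * K * exp (d * x2)) by nra.
  assert (Hb : B * exp ((c - d) * x2) <= 2 * K).
  { apply (Rmult_le_reg_r (exp (d * x2) * exp (- c * x2))).
    - apply Rmult_lt_0_compat; apply exp_pos.
    - replace (B * exp ((c - d) * x2) * (exp (d * x2) * exp (- c * x2))) with B.
      + generalize (exp_pos (- c * x2)). nra.
      + rewrite Rmult_assoc, <- !exp_plus.
        replace ((c - d) * x2 + (d * x2 + - c * x2)) with 0 by ring.
        rewrite exp_0. ring. }
  assert (Hl : 2 * K / B <= (c - d) * x2).
  { replace (2 * K / B) with ((c - d) * (2 * K / B / (c - d))) by (field; lra).
    apply Rmult_le_compat_l; lra. }
  generalize (exp_ineq1_le ((c - d) * x2)). intros He.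
  assert (B * (1 + 2 * K / B) <= 2 * K) by nra.
  replace (B * (1 + 2 * K / B)) with (B + 2 * K) in H by (field; lra). lra.
Qed.

(** Where T > 0 its derivative is nonzero: a positive one forces growth like exp(c x) to the right,
    a negative one the same after reflection. *)
Lemma no_positive_value (T T1 : R -> R) (c d : R) :
  0 <= d < c ->
  (forall x, is_derive T x (T1 x)) ->
  (forall x, 0 < T x -> c * T x <= T1 x \/ T1 x <= - (c * T x)) ->
  dominated d T -> forall x, T x <= 0.
Proof.
  intros Hdc HT Hdi Hdom x. apply Rnot_lt_le. intros Hx.
  assert (A := positive_growth T T1 c d x Hdc HT Hdi Hdom Hx).
  assert (B : - T1 x <= 0).
  { replace (- T1 x) with ((fun t => - T1 (- t)) (- x)) by (simpl; f_equal; f_equal; ring).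
    apply (positive_growth (fun t => T (- t)) (fun t => - T1 (- t)) c d (- x)); auto.
    - intros t. apply is_derive_opp_arg, HT.
    - intros t Ht. destruct (Hdi (- t) Ht); lra.
    - now apply dominated_opp_arg.
    - now rewrite Ropp_involutive. }
  destruct (Hdi x Hx); nra.
Qed.

(** * Evaluation at complex spectral parameters *)

(** The weights [c] stay arbitrary so that the same linear lemmas serve powers of a real z and the
    real and imaginary parts of powers of a complex z. *)
Definition ev (n : nat) (c a : nat -> R) : R :=
  sum_f_R0 (fun l => a (n - l)%nat * c l) n.

Definition cev (n : nat) (z : C) (a : nat -> R) : C :=
  (ev n (fun l => Re (Cpow z l)) a, ev n (fun l => Im (Cpow z l)) a).

Lemma ev_lin (n : nat) (c a b : nat -> R) (p q : R) :
  ev n c (fun l => p * a l + q * b l) = p * ev n c a + q * ev n c b.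
Proof.
  unfold ev. rewrite !scal_sum, <- sum_plus. apply sum_eq. intros; ring.
Qed.

Lemma ev_is_derive (n : nat) (c : nat -> R) (a da : nat -> R -> R) (x : R) :
  (forall l, (l <= n)%nat -> is_derive (a l) x (da l x)) ->
  is_derive (fun t => ev n c (fun l => a l t)) x (ev n c (fun l => da l x)).
Proof.
  intros H. apply (is_derive_sum (fun l t => a (n - l)%nat t * c l)
    (fun l t => da (n - l)%nat t * c l)).
  intros l Hl.
  apply (is_derive_ext (fun t => c l * a (n - l)%nat t)); [intros; apply Rmult_comm|].
  rewrite Rmult_comm. apply is_derive_scal, H. lia.
Qed.

Lemma ev_dominated (n : nat) (c : nat -> R) (a : nat -> R -> R) (d : R) :
  (forall l, (l <= n)%nat -> dominated d (a l)) ->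
  dominated d (fun t => ev n c (fun l => a l t)).
Proof.
  intros H. apply (dominated_sum d (fun l t => a (n - l)%nat t * c l)).
  intros l Hl. apply (dominated_ext d (fun t => c l * a (n - l)%nat t));
    [intros; apply Rmult_comm|].
  apply dominated_scal, H. lia.
Qed.

(** Shifting the weights is multiplication by z. The ends of the sums match because g_0 is constant
    and h_n = w f_n. *)
Lemma ev_shift (n : nat) (w : R -> R) (f g h dg : nat -> R -> R) (c : nat -> R) (x : R) :
  zero_curvature n w f g h dg ->
  ev n (fun l => c (S l)) (fun l => dg l x)
  = w x * ev n c (fun l => f l x) - ev n c (fun l => h l x).
Proof.
  intros Z.
  replace (w x * ev n c (fun l => f l x) - ev n c (fun l => h l x))
    with (ev n c (fun l => w x * f l x + -1 * h l x)) by (rewrite ev_lin; ring).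
  generalize (zc_g _ _ _ _ _ _ Z) (zc_gn _ _ _ _ _ _ Z x) (zc_dg0 _ _ _ _ _ _ Z x).
  clear Z. intros Hg Hn H0. unfold ev. destruct n as [|m].
  - simpl. rewrite H0, Hn. ring.
  - rewrite (decomp_sum (fun l => (w x * f (S m - l)%nat x + -1 * h (S m - l)%nat x) * c l))
      by lia.
    rewrite tech5, Nat.sub_diag, H0, Nat.sub_0_r, Hn. simpl pred.
    ring_simplify. apply sum_eq. intros l Hl.
    replace (S m - l)%nat with (S (m - l)) by lia. rewrite Hg by lia.
    replace (S m - S l)%nat with (m - l)%nat by lia. ring.
Qed.

(* The two functions are evaluations of one real polynomial, on R and on C. *)
Definition polypair (p : R -> R) (P : C -> C) : Prop :=
  exists l : list R,
    (forall t, p t = fold_right (fun a v => a + t * v) 0 l)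
    /\ (forall z, P z = fold_right (fun a v => (RtoC a + z * v)%C) (RtoC 0) l).

Lemma polypair_const (a : R) : polypair (fun _ => a) (fun _ => RtoC a).
Proof. exists (a :: nil). simpl. split; intros; [ring | ring]. Qed.

Lemma polypair_id : polypair (fun t => t) (fun z => z).
Proof. exists (0 :: 1 :: nil). simpl. split; intros; ring. Qed.

Lemma polypair_plus (p q : R -> R) (P Q : C -> C) :
  polypair p P -> polypair q Q ->
  polypair (fun t => p t + q t) (fun z => (P z + Q z)%C).
Proof.
  intros [l [H1 H2]] [m [H3 H4]].
  enough (E : exists k, (forall t : R,
      fold_right (fun a v => a + t * v) 0 l + fold_right (fun a v => a + t * v) 0 m
      = fold_right (fun a v => a + t * v) 0 k)
    /\ (forall z : C, (fold_right (fun a v => (RtoC a + z * v)%C) (RtoC 0) l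
      + fold_right (fun a v => (RtoC a + z * v)%C) (RtoC 0) m)%C
      = fold_right (fun a v => (RtoC a + z * v)%C) (RtoC 0) k)).
  { destruct E as [k [E1 E2]]. exists k.
    split; intros; [rewrite H1, H3; apply E1 | rewrite H2, H4; apply E2]. }
  clear. revert m. induction l as [|a l IH]; intros m.
  - exists m. split; intros; simpl; ring.
  - destruct m as [|b m].
    + exists (a :: l). split; intros; simpl; ring.
    + destruct (IH m) as [k [E1 E2]]. exists (a + b :: k). simpl. split; intros.
      * rewrite <- E1. ring.
      * rewrite <- E2, RtoC_plus. ring.
Qed.

Lemma polypair_scal (c : R) (p : R -> R) (P : C -> C) :
  polypair p P -> polypair (fun t => c * p t) (fun z => (RtoC c * P z)%C).
Proof.
  intros [l [H1 H2]]. exists (map (Rmult c) l). split.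
  - intros t. rewrite H1. clear. induction l as [|a l IH]; simpl; [ring|].
    rewrite <- IH. ring.
  - intros z. rewrite H2. clear. induction l as [|a l IH]; simpl; [ring|].
    rewrite <- IH, RtoC_mult. ring.
Qed.

Lemma polypair_shift (p : R -> R) (P : C -> C) :
  polypair p P -> polypair (fun t => t * p t) (fun z => (z * P z)%C).
Proof.
  intros [l [H1 H2]]. exists (0 :: l). simpl. split; intros.
  - rewrite H1. ring.
  - rewrite H2. ring.
Qed.

Lemma polypair_ext (p q : R -> R) (P Q : C -> C) :
  (forall t, p t = q t) -> (forall z, P z = Q z) -> polypair p P -> polypair q Q.
Proof.
  intros Hp Hq [l [H1 H2]]. exists l. split; intros; [rewrite <- Hp | rewrite <- Hq]; auto.
Qed.

Lemma polypair_mult (p q : R -> R) (P Q : C -> C) :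
  polypair p P -> polypair q Q ->
  polypair (fun t => p t * q t) (fun z => (P z * Q z)%C).
Proof.
  intros [l [H1 H2]] Hq.
  apply (polypair_ext (fun t => fold_right (fun a v => a + t * v) 0 l * q t) _
     (fun z => (fold_right (fun a v => (RtoC a + z * v)%C) (RtoC 0) l * Q z)%C));
    [intros; now rewrite H1 | intros; now rewrite H2 |].
  clear H1 H2. induction l as [|a l IH]; simpl.
  - apply (polypair_ext (fun _ => 0) _ (fun _ => RtoC 0)); try (intros; ring).
    apply polypair_const.
  - eapply (polypair_ext _ _ _ _ _ _
      (polypair_plus _ _ _ _ (polypair_scal a _ _ Hq) (polypair_shift _ _ IH))).
    Unshelve.
    + intros; simpl; ring.
    + intros; simpl; ring.
Qed.

Lemma polypair_zero (p : R -> R) (P : C -> C) :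
  polypair p P -> (forall t, p t = 0) -> forall z, P z = RtoC 0.
Proof.
  intros [l [H1 H2]] H0 z. rewrite H2.
  assert (E : forall t : R, fold_right (fun a v => a + t * v) 0 l = 0)
    by (intros; now rewrite <- H1).
  clear -E. induction l as [|a l IH]; [easy|]. simpl in *.
  assert (Ha : a = 0) by (rewrite <- (E 0); ring).
  rewrite IH.
  - rewrite Ha. ring.
  - intros t. destruct (Req_dec t 0) as [->|Ht].
    (* At t = 0 the factor t cannot be cancelled; the value there follows by continuity. *)
    + set (v := fun s : R => fold_right (fun a0 v0 => a0 + s * v0) 0 l).
      assert (Cv : continuous v 0).
      { unfold v. clear. induction l as [|b l IH]; simpl.
        - apply continuous_const.
        - apply (continuous_plus (fun _ => b)); [apply continuous_const|].
          apply (continuous_mult (fun s : R => s)); [apply continuous_id | apply IH]. }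
      apply NNPP. intros Hn. change (v 0 <> 0) in Hn.
      destruct (Cv (fun s => s <> 0)) as [e He].
      { exists (mkposreal (Rabs (v 0)) (Rabs_pos_lt _ Hn)). intros s Hs Hs0.
        unfold ball in Hs; simpl in Hs. unfold AbsRing_ball, abs, minus, plus, opp in Hs.
        simpl in Hs. rewrite Hs0, Rplus_0_l, Rabs_Ropp in Hs. lra. }
      generalize (cond_pos e); intros Hep.
      apply (He (e / 2)).
      { unfold ball; simpl. unfold AbsRing_ball, abs, minus, plus, opp; simpl.
        rewrite Rabs_pos_eq; lra. }
      unfold v. generalize (E (e / 2)). rewrite Ha. intros H. nra.
    + generalize (E t). rewrite Ha. intros H. nra.
Qed.

Lemma polypair_ev (n : nat) (a : nat -> R) :
  polypair (fun t => ev n (fun l => t ^ l) a) (fun z => cev n z a).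
Proof.
  enough (H : forall (a : nat -> R) (n : nat),
    polypair (fun t => sum_f_R0 (fun l => a l * t ^ l) n)
      (fun z => (sum_f_R0 (fun l => a l * Re (Cpow z l)) n,
                 sum_f_R0 (fun l => a l * Im (Cpow z l)) n)))
    by apply (H (fun l => a (n - l)%nat)).
  clear. intros a n.
  assert (Hp : forall l, polypair (fun t => t ^ l) (fun z => Cpow z l)).
  { induction l as [|l IH]; simpl; [apply polypair_const | now apply polypair_shift]. }
  induction n as [|n IH]; simpl.
  - apply (polypair_ext (fun t => a 0%nat * t ^ 0) _ (fun z => (RtoC (a 0%nat) * Cpow z 0)%C)).
    + easy.
    + intros z. unfold Cmult, RtoC; simpl. f_equal; ring.
    + apply polypair_scal, Hp.
  - eapply (polypair_ext _ _ _ _ _ _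
      (polypair_plus _ _ _ _ IH (polypair_scal (a (S n)) _ _ (Hp (S n))))).
    Unshelve.
    + easy.
    + intros z. unfold Cplus, Cmult, RtoC; simpl. f_equal; ring.
Qed.

Fixpoint cprodn (F : nat -> C) (k : nat) : C :=
  match k with
  | O => RtoC 1
  | S k' => (cprodn F k' * F k')%C
  end.

Lemma polypair_prodn (E : nat -> R) (N : nat) :
  polypair (fun t => prodn (fun m => t - E m) N)
           (fun z => cprodn (fun m => (z - RtoC (E m))%C) N).
Proof.
  induction N as [|N IH]; simpl; [apply polypair_const|].
  apply polypair_mult; [easy|].
  apply (polypair_ext (fun t => t + - E N) _ (fun z => (z + RtoC (- E N))%C)).
  - easy.
  - intros z. now rewrite RtoC_opp.
  - apply (polypair_plus _ _ _ _ polypair_id (polypair_const _)).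
Qed.

(** The curve identity is given at real z; it extends because a polynomial vanishing on the real
    line has zero coefficients. *)
Lemma curve_identity_complex (n N : nat) (f g h E : nat -> R) :
  (forall t : R, t ^ 2 * ev n (fun l => t ^ l) g ^ 2
     + t * ev n (fun l => t ^ l) f * ev n (fun l => t ^ l) h
     = prodn (fun m => t - E m) N) ->
  forall z : C, (z * z * (cev n z g * cev n z g) + z * (cev n z f * cev n z h)
     = cprodn (fun m => z - RtoC (E m)) N)%C.
Proof.
  intros H z.
  assert (Hz : (z * z * (cev n z g * cev n z g) + z * (cev n z f * cev n z h)
     + RtoC (-1) * cprodn (fun m => z - RtoC (E m)) N = RtoC 0)%C).
  { apply (polypair_zero (fun t => t * t * (ev n (fun l => t ^ l) g * ev n (fun l => t ^ l) g)
       + t * (ev n (fun l => t ^ l) f * ev n (fun l => t ^ l) h)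
       + (-1) * prodn (fun m => t - E m) N)
     (fun z => z * z * (cev n z g * cev n z g) + z * (cev n z f * cev n z h)
     + RtoC (-1) * cprodn (fun m => z - RtoC (E m)) N)%C).
    - apply polypair_plus; [apply polypair_plus|apply polypair_scal, polypair_prodn].
      + apply polypair_mult; apply polypair_mult; auto using polypair_id, polypair_ev.
      + apply polypair_mult; [apply polypair_id|].
        apply polypair_mult; auto using polypair_ev.
    - intros t. rewrite <- H. ring. }
  replace (cprodn (fun m => z - RtoC (E m)) N)%C
    with (RtoC 0 + RtoC 1 * cprodn (fun m => z - RtoC (E m)) N)%C by ring.
  rewrite <- Hz.
  replace (RtoC (-1)) with (- RtoC 1)%C by now rewrite <- RtoC_opp.
  ring.
Qed.

(* Rank-one factorisation of the matrix ((F, zG - s), (zG + s, -zH)). *)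
Lemma rank_one_factorisation (F G H z s : C) :
  z <> RtoC 0 -> (z * z * (G * G) + z * (F * H) = s * s)%C ->
  exists p k q m : C,
    (F = p * q /\ RtoC 2 * G = k * q + p * m /\ H = - (z * (k * m))
     /\ RtoC 2 * s = z * (k * q - p * m))%C.
Proof.
  intros Hz HR.
  assert (E : exists p q r t : C,
    (F = p * r /\ z * G - s = p * t /\ z * G + s = q * r /\ - (z * H) = q * t)%C).
  { set (b := (z * G - s)%C). set (c := (z * G + s)%C).
    assert (Hd : (F * - (z * H) = b * c)%C).
    { unfold b, c. replace ((z * G - s) * (z * G + s))%C with (z * z * (G * G) - s * s)%C by ring.
      rewrite <- HR. ring. }
    set (d := (- (z * H))%C) in *. clearbody b c d.
    (* If F is nonzero, the second row is a multiple of the first; otherwise the vanishing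
       determinant makes an off-diagonal entry zero. *)
    destruct (classic (F = RtoC 0)) as [HF|HF].
    - assert (Hbc : (b * c = RtoC 0)%C) by (rewrite <- Hd, HF; ring).
      destruct (classic (b = RtoC 0)) as [Hb|Hb].
      + exists (RtoC 0), (RtoC 1), c, d. rewrite HF, Hb. repeat split; ring.
      + assert (Hc : c = RtoC 0).
        { apply NNPP. intros Hc. now apply (Cmult_neq_0 b c). }
        exists b, d, (RtoC 0), (RtoC 1). rewrite HF, Hc. repeat split; ring.
    - exists F, c, (RtoC 1), (b / F)%C. repeat split.
      + ring.
      + field; easy.
      + ring.
      + replace (c * (b / F))%C with (F * d / F)%C by (rewrite Hd; field; easy).
        field; easy. }
  destruct E as [p [q [r [t [E1 [E2 [E3 E4]]]]]]].
  exists p, (q / z)%C, r, (t / z)%C. repeat split.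
  - easy.
  - replace (q / z * r + p * (t / z))%C with ((q * r + p * t) / z)%C by (field; easy).
    rewrite <- E2, <- E3. unfold Cdiv.
    replace (RtoC 2) with (RtoC 1 + RtoC 1)%C by (rewrite <- RtoC_plus; f_equal; ring).
    field; easy.
  - replace (- (z * (q / z * (t / z))))%C with (- (q * t) / z)%C by (field; easy).
    rewrite <- E4. field; easy.
  - replace (z * (q / z * r - p * (t / z)))%C with (q * r - p * t)%C by (field; easy).
    rewrite <- E2, <- E3.
    replace (RtoC 2) with (RtoC 1 + RtoC 1)%C by (rewrite <- RtoC_plus; f_equal; ring).
    ring.
Qed.

(** * The energy form *)

(* For a solution psi' = kap - psi, z kap' = w psi + z kap of the spectral problem,
   [enform] is Im (z kap psi^* ) - eta |psi|^2 and [denform] its x-derivative, in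
   which w cancels. *)
Definition enform (z : C) (eta : R) (psi kap : C) : R :=
  (Re z * Im kap + Im z * Re kap) * Re psi - (Re z * Re kap - Im z * Im kap) * Im psi
  - eta * (Re psi ^ 2 + Im psi ^ 2).

Definition denform (z : C) (eta : R) (psi kap : C) : R :=
  Im z * (Re kap ^ 2 + Im kap ^ 2) - 2 * eta * (Re kap * Re psi + Im kap * Im psi)
  + 2 * eta * (Re psi ^ 2 + Im psi ^ 2).

Definition sqnorm (psi kap : C) : R :=
  Re psi ^ 2 + Im psi ^ 2 + (Re kap ^ 2 + Im kap ^ 2).

(** The difference of the two sides is A/6 + 2 B1/3 + B2/2 + B3/12 in the nonnegative terms asserted
    below. *)
Lemma denform_ge (z : C) (eta : R) (psi kap : C) :
  0 < Im z -> Im z / 2 <= eta <= Im z ->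
  Im z / 4 * sqnorm psi kap <= denform z eta psi kap.
Proof.
  unfold denform, sqnorm. generalize (Im z) (Re psi) (Im psi) (Re kap) (Im kap).
  clear. intros y p1 p2 k1 k2 Hy He.
  assert (A : 0 <= eta * ((2 * k1 - 3 * p1) ^ 2 + (2 * k2 - 3 * p2) ^ 2))
    by (apply Rmult_le_pos; [lra | apply Rplus_le_le_0_compat; apply pow2_ge_0]).
  assert (B1 : 0 <= (y - eta) * (k1 ^ 2 + k2 ^ 2)) by (apply Rmult_le_pos; [lra | apply Rplus_le_le_0_compat; apply pow2_ge_0]).
  assert (B2 : 0 <= (eta - y / 2) * (p1 ^ 2 + p2 ^ 2)) by (apply Rmult_le_pos; [lra | apply Rplus_le_le_0_compat; apply pow2_ge_0]).
  assert (B3 : 0 <= y * (k1 ^ 2 + k2 ^ 2)) by (apply Rmult_le_pos; [lra | apply Rplus_le_le_0_compat; apply pow2_ge_0]).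
  lra.
Qed.

Ltac by_squares a b c d :=
  generalize (pow2_ge_0 a) (pow2_ge_0 b) (pow2_ge_0 c) (pow2_ge_0 d); lra.

Lemma enform_le (z : C) (eta : R) (psi kap : C) :
  0 < Im z -> 0 <= eta <= Im z ->
  Rabs (enform z eta psi kap) <= (Rabs (Re z) + 2 * Im z) * sqnorm psi kap.
Proof.
  unfold enform, sqnorm.
  generalize (Re z) (Im z) (Re psi) (Im psi) (Re kap) (Im kap).
  clear. intros a y p1 p2 k1 k2 Hy He.
  set (S := p1 ^ 2 + p2 ^ 2 + (k1 ^ 2 + k2 ^ 2)).
  assert (HS : 0 <= S) by (unfold S; by_squares p1 p2 k1 k2).
  assert (A : Rabs (k2 * p1 - k1 * p2) <= S).
  { unfold S. apply Rabs_le.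
    split; [by_squares (k2 + p1) (k1 - p2) (k2 - p1) (k1 + p2) | by_squares (k2 - p1) (k1 + p2) (k2 + p1) (k1 - p2)]. }
  assert (B : Rabs (k1 * p1 + k2 * p2) <= S).
  { unfold S. apply Rabs_le. split; by_squares (k2 + p2) (k1 + p1) (k2 - p2) (k1 - p1). }
  replace ((a * k2 + y * k1) * p1 - (a * k1 - y * k2) * p2 - eta * (p1 ^ 2 + p2 ^ 2))
    with (a * (k2 * p1 - k1 * p2) + (y * (k1 * p1 + k2 * p2) + - (eta * (p1 ^ 2 + p2 ^ 2))))
    by ring.
  eapply Rle_trans; [apply Rabs_triang|].
  assert (A' : Rabs (a * (k2 * p1 - k1 * p2)) <= Rabs a * S).
  { rewrite Rabs_mult. apply Rmult_le_compat_l; [apply Rabs_pos | easy]. }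
  assert (B' : Rabs (y * (k1 * p1 + k2 * p2) + - (eta * (p1 ^ 2 + p2 ^ 2))) <= 2 * y * S).
  { eapply Rle_trans; [apply Rabs_triang|]. rewrite Rabs_mult, Rabs_Ropp, (Rabs_pos_eq y) by lra.
    rewrite (Rabs_pos_eq (eta * _)) by (apply Rmult_le_pos; [lra | by_squares p1 p2 k1 k2]).
    assert (eta * (p1 ^ 2 + p2 ^ 2) <= y * S).
    { apply Rmult_le_compat; [lra | by_squares p1 p2 k1 k2 | lra | unfold S; by_squares p1 p2 k1 k2]. }
    nra. }
  lra.
Qed.

(* The product of the values of [enform] on two solutions with product matrix
   ((F, G - s/z), (G + s/z, -H/z)), where P = zG and rho = |s|^2. *)
Definition enprod (z : C) (eta rho : R) (F P H : C) : R :=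
  / 2 * (Re P ^ 2 + Im P ^ 2) - / 2 * rho
  + / 2 * ((Re z * Re H - Im z * Im H) * Re F + (Re z * Im H + Im z * Re H) * Im F)
  - 2 * eta * (Im P * Re F - Re P * Im F) + eta ^ 2 * (Re F ^ 2 + Im F ^ 2).

Definition denprod (z : C) (eta : R) (F P H dF dP dH : C) : R :=
  Re P * Re dP + Im P * Im dP
  + / 2 * ((Re z * Re dH - Im z * Im dH) * Re F + (Re z * Re H - Im z * Im H) * Re dF
           + ((Re z * Im dH + Im z * Re dH) * Im F + (Re z * Im H + Im z * Re H) * Im dF))
  - 2 * eta * (Im dP * Re F + Im P * Re dF - (Re dP * Im F + Re P * Im dF))
  + eta ^ 2 * (2 * (Re F * Re dF + Im F * Im dF)).

(** Put A = z k conj(p) and B = z m conj(q). Then Im A Im B = (Re(A conj(B)) - Re(A B))/2 with A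
    conj(B) = (zG + s) conj(zG - s) and A B = -z H conj(F), so s enters only through its modulus.
    The last identity comes from zG + s = z k q and F = p q. *)
Lemma enprod_factor (w eta : R) (z F G H s p k q m : C) :
  (F = p * q)%C -> (RtoC 2 * G = k * q + p * m)%C -> (H = - (z * (k * m)))%C ->
  (RtoC 2 * s = z * (k * q - p * m))%C ->
  enprod z eta (Re s ^ 2 + Im s ^ 2) F (z * G) H = enform z eta p k * enform z eta q m
  /\ denprod z eta F (z * G) H (RtoC 2 * (G - F)) (RtoC w * F - H)
        (RtoC 2 * (H - RtoC w * G))
     = denform z eta p k * enform z eta q m + enform z eta p k * denform z eta q m
  /\ Im ((z * G + s) * Cconj F) - eta * (Re F ^ 2 + Im F ^ 2)
     = (Re q ^ 2 + Im q ^ 2) * enform z eta p k.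
Proof.
  intros -> HG -> Hs.
  destruct z as [a y], G as [G1 G2], s as [s1 s2], p as [p1 p2], k as [k1 k2],
    q as [q1 q2], m as [m1 m2].
  unfold Cmult, Cplus, Copp, Cminus, RtoC in HG, Hs; simpl in HG, Hs.
  injection HG as HG1 HG2. injection Hs as Hs1 Hs2.
  replace G1 with (/ 2 * (k1 * q1 - k2 * q2 + (p1 * m1 - p2 * m2))) by lra.
  replace G2 with (/ 2 * (k1 * q2 + k2 * q1 + (p1 * m2 + p2 * m1))) by lra.
  replace s1 with (/ 2 * (a * (k1 * q1 - k2 * q2 - (p1 * m1 - p2 * m2))
     - y * (k1 * q2 + k2 * q1 - (p1 * m2 + p2 * m1)))) by lra.
  replace s2 with (/ 2 * (a * (k1 * q2 + k2 * q1 - (p1 * m2 + p2 * m1))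
     + y * (k1 * q1 - k2 * q2 - (p1 * m1 - p2 * m2)))) by lra.
  unfold enprod, denprod, enform, denform, Cmult, Cplus, Cminus, Copp, Cconj, RtoC, Re, Im;
    simpl fst; simpl snd.
  repeat split; field.
Qed.

Lemma complex_eq0 (p : C) : Re p ^ 2 + Im p ^ 2 = 0 -> p = RtoC 0.
Proof.
  destruct p as [p1 p2]; unfold Re, Im, RtoC; simpl fst; simpl snd. intros H.
  generalize (pow2_ge_0 p1) (pow2_ge_0 p2). intros A B.
  f_equal; apply Rsqr_0_uniq; unfold Rsqr; lra.
Qed.

Lemma sqnorm_pos (p k : C) : p <> RtoC 0 \/ k <> RtoC 0 -> 0 < sqnorm p k.
Proof.
  unfold sqnorm. intros H.
  assert (A : 0 <= Re p ^ 2 + Im p ^ 2) by by_squares (Re p) (Im p) (Re p) (Im p).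
  assert (B : 0 <= Re k ^ 2 + Im k ^ 2) by by_squares (Re k) (Im k) (Re k) (Im k).
  destruct (Rle_lt_or_eq_dec 0 (Re p ^ 2 + Im p ^ 2)) as [|E1]; [easy|lra|].
  destruct (Rle_lt_or_eq_dec 0 (Re k ^ 2 + Im k ^ 2)) as [|E2]; [easy|lra|].
  destruct H as [H|H]; exfalso; apply H; now apply complex_eq0.
Qed.

Lemma ev_is_derive_F (n : nat) (w : R -> R) (f g h dg : nat -> R -> R) (c : nat -> R) (x : R) :
  zero_curvature n w f g h dg ->
  is_derive (fun t => ev n c (fun l => f l t)) x
    (2 * (ev n c (fun l => g l x) - ev n c (fun l => f l x))).
Proof.
  intros Z. eapply is_derive_eq.
  - apply (ev_is_derive n c f (fun l t => 2 * g l t + -2 * f l t)).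
    intros l Hl. eapply is_derive_eq; [now apply (zc_f _ _ _ _ _ _ Z) | ring].
  - rewrite ev_lin. ring.
Qed.

Lemma ev_is_derive_H (n : nat) (w : R -> R) (f g h dg : nat -> R -> R) (c : nat -> R) (x : R) :
  zero_curvature n w f g h dg ->
  is_derive (fun t => ev n c (fun l => h l t)) x
    (2 * (ev n c (fun l => h l x) - w x * ev n c (fun l => g l x))).
Proof.
  intros Z. eapply is_derive_eq.
  - apply (ev_is_derive n c h (fun l t => 2 * h l t + (-2 * w t) * g l t)).
    intros l Hl. eapply is_derive_eq; [now apply (zc_h _ _ _ _ _ _ Z) | ring].
  - rewrite ev_lin. ring.
Qed.

Lemma ev_is_derive_zG (n : nat) (w : R -> R) (f g h dg : nat -> R -> R) (c : nat -> R) (x : R) :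
  zero_curvature n w f g h dg ->
  is_derive (fun t => ev n (fun l => c (S l)) (fun l => g l t)) x
    (w x * ev n c (fun l => f l x) - ev n c (fun l => h l x)).
Proof.
  intros Z. rewrite <- (ev_shift n w f g h dg c x Z).
  apply (ev_is_derive n _ g dg). intros l Hl. now apply (zc_dg _ _ _ _ _ _ Z).
Qed.

Lemma ev_Cpow_S (n : nat) (z : C) (a : nat -> R) :
  ev n (fun l => Re (Cpow z (S l))) a = Re (z * cev n z a)%C
  /\ ev n (fun l => Im (Cpow z (S l))) a = Im (z * cev n z a)%C.
Proof.
  destruct z as [x y]. unfold cev, ev, Cmult, Re, Im; simpl fst; simpl snd. split.
  - rewrite !scal_sum, <- minus_sum. apply sum_eq. intros; simpl. ring.
  - rewrite !scal_sum, <- sum_plus. apply sum_eq. intros; simpl. ring.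
Qed.

Lemma enprod_is_derive (n : nat) (w : R -> R) (f g h dg : nat -> R -> R) (z : C)
  (eta rho x : R) :
  zero_curvature n w f g h dg ->
  is_derive (fun t => enprod z eta rho (cev n z (fun l => f l t))
                       (z * cev n z (fun l => g l t)) (cev n z (fun l => h l t))) x
    (let F := cev n z (fun l => f l x) in
     let G := cev n z (fun l => g l x) in
     let H := cev n z (fun l => h l x) in
     denprod z eta F (z * G) H (RtoC 2 * (G - F)) (RtoC (w x) * F - H)
        (RtoC 2 * (H - RtoC (w x) * G))).
Proof.
  intros Z. cbv zeta.
  set (cr := fun l => Re (Cpow z l)). set (ci := fun l => Im (Cpow z l)).
  set (F1 := fun t => ev n cr (fun l => f l t)). set (F2 := fun t => ev n ci (fun l => f l t)).
  set (H1 := fun t => ev n cr (fun l => h l t)). set (H2 := fun t => ev n ci (fun l => h l t)).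
  set (G1 := ev n cr (fun l => g l x)). set (G2 := ev n ci (fun l => g l x)).
  set (P1 := fun t => ev n (fun l => cr (S l)) (fun l => g l t)).
  set (P2 := fun t => ev n (fun l => ci (S l)) (fun l => g l t)).
  assert (dF1 : is_derive F1 x (2 * (G1 - F1 x)))
    by apply (ev_is_derive_F n w f g h dg cr x Z).
  assert (dF2 : is_derive F2 x (2 * (G2 - F2 x)))
    by apply (ev_is_derive_F n w f g h dg ci x Z).
  assert (dH1 : is_derive H1 x (2 * (H1 x - w x * G1)))
    by apply (ev_is_derive_H n w f g h dg cr x Z).
  assert (dH2 : is_derive H2 x (2 * (H2 x - w x * G2)))
    by apply (ev_is_derive_H n w f g h dg ci x Z).
  assert (dP1 : is_derive P1 x (w x * F1 x - H1 x))
    by apply (ev_is_derive_zG n w f g h dg cr x Z).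
  assert (dP2 : is_derive P2 x (w x * F2 x - H2 x))
    by apply (ev_is_derive_zG n w f g h dg ci x Z).
  apply (is_derive_ext (fun t => enprod z eta rho (F1 t, F2 t) (P1 t, P2 t) (H1 t, H2 t))).
  { intros t. do 2 f_equal. unfold P1, P2, cr, ci.
    rewrite (proj1 (ev_Cpow_S n z (fun l => g l t))), (proj2 (ev_Cpow_S n z (fun l => g l t))).
    now destruct (Cmult z _). }
  assert (EP1 : P1 x = Re (z * cev n z (fun l => g l x))%C) by apply ev_Cpow_S.
  assert (EP2 : P2 x = Im (z * cev n z (fun l => g l x))%C) by apply ev_Cpow_S.
  unfold enprod, denprod. rewrite <- EP1, <- EP2.
  unfold cev. fold cr ci. change (ev n cr (fun l => f l x)) with (F1 x).
  change (ev n ci (fun l => f l x)) with (F2 x).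
  change (ev n cr (fun l => h l x)) with (H1 x).
  change (ev n ci (fun l => h l x)) with (H2 x).
  fold G1 G2.
  clearbody F1 F2 G1 G2 H1 H2 P1 P2.
  unfold Cmult, Cminus, Cplus, Copp, RtoC, Re, Im; simpl fst; simpl snd.
  auto_derive.
  - repeat split; eexists; eassumption.
  - change (fun x0 : R => F1 x0) with F1. change (fun x0 : R => F2 x0) with F2.
    change (fun x0 : R => H1 x0) with H1. change (fun x0 : R => H2 x0) with H2.
    change (fun x0 : R => P1 x0) with P1. change (fun x0 : R => P2 x0) with P2.
    rewrite (is_derive_unique _ _ _ dF1), (is_derive_unique _ _ _ dF2),
      (is_derive_unique _ _ _ dH1), (is_derive_unique _ _ _ dH2),
      (is_derive_unique _ _ _ dP1), (is_derive_unique _ _ _ dP2).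
    field.
Qed.

Lemma enprod_dominated (d : R) (z : C) (eta rho : R) (F1 F2 P1 P2 H1 H2 : R -> R) :
  0 < d ->
  dominated d F1 -> dominated d F2 -> dominated d P1 -> dominated d P2 ->
  dominated d H1 -> dominated d H2 ->
  dominated (2 * d) (fun t => enprod z eta rho (F1 t, F2 t) (P1 t, P2 t) (H1 t, H2 t)).
Proof.
  intros Hd DF1 DF2 DP1 DP2 DH1 DH2.
  apply (dominated_ext _ (fun t =>
    / 2 * (P1 t * P1 t) + (/ 2 * (P2 t * P2 t) + (- / 2 * rho
    + (/ 2 * Re z * (H1 t * F1 t) + (- / 2 * Im z * (H2 t * F1 t)
    + (/ 2 * Re z * (H2 t * F2 t) + (/ 2 * Im z * (H1 t * F2 t)
    + (- 2 * eta * (P2 t * F1 t) + (2 * eta * (P1 t * F2 t)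
    + (eta ^ 2 * (F1 t * F1 t) + eta ^ 2 * (F2 t * F2 t)))))))))))).
  { intros t. unfold enprod, Re, Im; simpl fst; simpl snd. field. }
  repeat apply dominated_plus;
    try (apply dominated_scal; now apply dominated_mult).
  apply (dominated_bounded _ _ (Rabs (- / 2 * rho))). intros; lra.
Qed.

Lemma enprod_nonpos (n : nat) (w : R -> R) (f g h dg : nat -> R -> R) (z s : C) (eta : R) :
  zero_curvature n w f g h dg -> 0 < Im z -> Im z / 2 <= eta <= Im z ->
  (forall x, (z * z * (cev n z (fun l => g l x) * cev n z (fun l => g l x))
     + z * (cev n z (fun l => f l x) * cev n z (fun l => h l x)) = s * s)%C) ->
  forall x, enprod z eta (Re s ^ 2 + Im s ^ 2) (cev n z (fun l => f l x))
              (z * cev n z (fun l => g l x)) (cev n z (fun l => h l x)) <= 0.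
Proof.
  intros Z Hy He HR.
  assert (Hz : z <> RtoC 0) by (intros ->; simpl in Hy; lra).
  set (B := Rabs (Re z) + 2 * Im z).
  assert (HB : 0 < B) by (unfold B; generalize (Rabs_pos (Re z)); lra).
  (* Ratio of the bounds in [denform_ge] and [enform_le]. Each factor of the product contributes
     [k], hence the rate [2 * k]; [d] stays below [k] because the quadratic [enprod] is dominated at
     rate [2 * d]. *)
  set (k := Im z / 4 / B).
  assert (Hk : 0 < k) by (unfold k; repeat apply Rdiv_lt_0_compat; lra).
  set (d := Rmin 1 (k / 2)).
  assert (Hd : 0 < d <= 1) by (split; [apply Rmin_pos; lra | apply Rmin_l]).
  assert (Hdk : 2 * d < 2 * k) by (generalize (Rmin_r 1 (k / 2)); unfold d; lra).
  eapply (no_positive_value _ _ (2 * k) (2 * d)); [lra | | |].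
  - intros x. now apply (enprod_is_derive n w f g h dg).
  - intros x. cbv zeta.
    destruct (rank_one_factorisation _ _ _ z s Hz (HR x)) as [p [kp [q [m [E1 [E2 [E3 E4]]]]]]].
    destruct (enprod_factor (w x) eta z _ _ _ s p kp q m E1 E2 E3 E4) as [T0 [T1 _]].
    rewrite T0, T1.
    assert (Hq : forall a b, k * Rabs (enform z eta a b) <= denform z eta a b).
    { intros a b. eapply Rle_trans; [|now apply denform_ge].
      replace (Im z / 4) with (k * B) by (unfold k; field; lra).
      rewrite Rmult_assoc. apply Rmult_le_compat_l; [lra|].
      apply enform_le; lra. }
    generalize (Hq p kp) (Hq q m).
    generalize (enform z eta p kp) (enform z eta q m) (denform z eta p kp) (denform z eta q m).
    clear - Hk. intros Q1 Q2 N1 N2 H1 H2 HT.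
    (* A positive product means equal signs: two negative energies give decay at rate 2k, two
       positive ones growth. *)
    destruct (Rtotal_order Q1 0) as [A|[A|A]].
    + assert (Q2 < 0) by nra. right.
      rewrite Rabs_left in H1, H2 by lra. nra.
    + subst; lra.
    + assert (0 < Q2) by nra. left.
      rewrite Rabs_pos_eq in H1, H2 by lra. nra.
  - assert (DF := fun c => ev_dominated n c f d (fun l Hl => proj1 (zc_dom _ _ _ _ _ _ Z l d Hl Hd))).
    assert (DG := fun c => ev_dominated n c g d
      (fun l Hl => proj1 (proj2 (zc_dom _ _ _ _ _ _ Z l d Hl Hd)))).
    assert (DH := fun c => ev_dominated n c h d
      (fun l Hl => proj2 (proj2 (zc_dom _ _ _ _ _ _ Z l d Hl Hd)))).
    eapply dominated_ext; [|apply (enprod_dominated d z eta (Re s ^ 2 + Im s ^ 2));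
      [lra | apply DF | apply DF | apply DG | apply DG | apply DH | apply DH]].
    intros t. simpl. f_equal.
    + now instantiate (1 := fun l => Im (Cpow z l)); instantiate (1 := fun l => Re (Cpow z l)).
    + instantiate (1 := fun l => Im (Cpow z (S l))); instantiate (1 := fun l => Re (Cpow z (S l))).
      rewrite (proj1 (ev_Cpow_S n z (fun l => g l t))), (proj2 (ev_Cpow_S n z (fun l => g l t))).
      now destruct (Cmult z _).
    + now instantiate (1 := fun l => Im (Cpow z l)); instantiate (1 := fun l => Re (Cpow z l)).
Qed.

(* A zero of the energy of either solution forces both energies to vanish at a
   maximum of their product; lowering eta would then make the product positive. *)
Lemma energy_nonzero (n : nat) (w : R -> R) (f g h dg : nat -> R -> R) (z s : C) :
  zero_curvature n w f g h dg -> 0 < Im z -> s <> RtoC 0 ->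
  (forall x, (z * z * (cev n z (fun l => g l x) * cev n z (fun l => g l x))
     + z * (cev n z (fun l => f l x) * cev n z (fun l => h l x)) = s * s)%C) ->
  forall x, let F := cev n z (fun l => f l x) in
    Im ((z * cev n z (fun l => g l x) + s) * Cconj F)
    - Im z * (Re F ^ 2 + Im F ^ 2) <> 0.
Proof.
  intros Z Hy Hs HR x.
  assert (Hz : z <> RtoC 0) by (intros ->; simpl in Hy; lra).
  destruct (rank_one_factorisation _ _ _ z s Hz (HR x)) as [p [k [q [m [E1 [E2 [E3 E4]]]]]]].
  assert (Hfac := fun eta => enprod_factor (w x) eta z _ _ _ s p k q m E1 E2 E3 E4).
  cbv zeta. rewrite (proj2 (proj2 (Hfac (Im z)))).
  assert (Hle : forall eta, Im z / 2 <= eta <= Im z ->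
    enform z eta p k * enform z eta q m <= 0).
  { intros eta He. rewrite <- (proj1 (Hfac eta)). now apply (enprod_nonpos n w f g h dg). }
  assert (Hcrit : forall eta, Im z / 2 <= eta <= Im z ->
    enform z eta p k * enform z eta q m = 0 ->
    denform z eta p k * enform z eta q m + enform z eta p k * denform z eta q m = 0).
  { intros eta He H0. rewrite <- (proj1 (proj2 (Hfac eta))).
    apply (interior_max_derive _ (x - 1) (x + 1) x _ ltac:(lra)
      (enprod_is_derive n w f g h dg z eta (Re s ^ 2 + Im s ^ 2) x Z)).
    intros t _. cbv beta. rewrite (proj1 (Hfac eta)), H0.
    now apply (enprod_nonpos n w f g h dg). }
  assert (Hs' : (z * (k * q - p * m) <> RtoC 0)%C).
  { rewrite <- E4. intros H. apply Hs.
    assert (RtoC 2 <> RtoC 0) by (intros H2; injection H2; lra).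
    apply NNPP. intros Hn. now apply (Cmult_neq_0 (RtoC 2) s). }
  assert (Np : forall eta, Im z / 2 <= eta <= Im z -> 0 < denform z eta p k).
  { intros eta He. eapply Rlt_le_trans; [|now apply denform_ge].
    apply Rmult_lt_0_compat; [lra|]. apply sqnorm_pos.
    destruct (classic (p = RtoC 0)) as [->|]; [|now left]. right. intros ->.
    apply Hs'. ring. }
  assert (Nq : forall eta, Im z / 2 <= eta <= Im z -> 0 < denform z eta q m).
  { intros eta He. eapply Rlt_le_trans; [|now apply denform_ge].
    apply Rmult_lt_0_compat; [lra|]. apply sqnorm_pos.
    destruct (classic (q = RtoC 0)) as [->|]; [|now left]. right. intros ->.
    apply Hs'. ring. }
  assert (I1 : Im z / 2 <= Im z <= Im z) by lra.
  assert (I2 : Im z / 2 <= Im z / 2 <= Im z) by lra.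
  assert (Hen : forall a b eta, enform z eta a b
    = enform z 0 a b - eta * (Re a ^ 2 + Im a ^ 2)) by (intros; unfold enform; ring).
  assert (En0 : forall b eta, enform z eta (RtoC 0) b = 0).
  { intros. unfold enform, RtoC, Re, Im; simpl. ring. }
  (* If q = 0, the second energy vanishes for every eta, so by [Hcrit] the first one does too; two
     values of eta force p = 0, which contradicts s <> 0. *)
  assert (Hq : q <> RtoC 0).
  { intros Hq0.
    assert (Q : forall eta, Im z / 2 <= eta <= Im z -> enform z eta p k = 0).
    { intros eta He. assert (H0 := Hcrit eta He). generalize (Nq eta He).
      rewrite Hq0, En0 in H0. rewrite Hq0. intros HN.
      specialize (H0 ltac:(ring)). rewrite Rmult_0_r, Rplus_0_l in H0.
      destruct (Rmult_integral _ _ H0); lra. }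
    assert (p = RtoC 0).
    { apply complex_eq0. assert (A1 := Q _ I1). assert (A2 := Q _ I2).
      rewrite (Hen p k) in A1, A2.
      apply (Rmult_eq_reg_l (Im z)); lra. }
    apply Hs'. rewrite Hq0, H. ring. }
  assert (Hp : p <> RtoC 0).
  { intros Hp0.
    assert (Q : forall eta, Im z / 2 <= eta <= Im z -> enform z eta q m = 0).
    { intros eta He. assert (H0 := Hcrit eta He). generalize (Np eta He).
      rewrite Hp0, En0 in H0. rewrite Hp0. intros HN.
      specialize (H0 ltac:(ring)). rewrite Rmult_0_l, Rplus_0_r in H0.
      destruct (Rmult_integral _ _ H0); lra. }
    assert (q = RtoC 0).
    { apply complex_eq0. assert (A1 := Q _ I1). assert (A2 := Q _ I2).
      rewrite (Hen q m) in A1, A2.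
      apply (Rmult_eq_reg_l (Im z)); lra. }
    apply Hs'. rewrite Hp0, H. ring. }
  assert (Hpos : forall a : C, a <> RtoC 0 -> 0 < Re a ^ 2 + Im a ^ 2).
  { intros a Ha. generalize (pow2_ge_0 (Re a)) (pow2_ge_0 (Im a)). intros A1 A2.
    destruct (Rle_lt_or_eq_dec 0 (Re a ^ 2 + Im a ^ 2)); [lra|easy|].
    exfalso. now apply Ha, complex_eq0. }
  intros H.
  assert (P0 : enform z (Im z) p k = 0).
  { generalize (Hpos q Hq). destruct (Rmult_integral _ _ H); lra. }
  assert (Q0 : enform z (Im z) q m = 0).
  { assert (H0 := Hcrit _ I1). generalize (Np _ I1). rewrite P0 in H0. intros HN.
    specialize (H0 ltac:(ring)). rewrite Rmult_0_l, Rplus_0_r in H0.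
    destruct (Rmult_integral _ _ H0); lra. }
  generalize (Hle _ I2). rewrite (Hen p k), (Hen q m).
  rewrite (Hen p k) in P0. rewrite (Hen q m) in Q0.
  replace (enform z 0 p k) with (Im z * (Re p ^ 2 + Im p ^ 2)) by lra.
  replace (enform z 0 q m) with (Im z * (Re q ^ 2 + Im q ^ 2)) by lra.
  generalize (Hpos p Hp) (Hpos q Hq). generalize (Re p ^ 2 + Im p ^ 2) (Re q ^ 2 + Im q ^ 2).
  intros a b Ha Hb. replace ((Im z * a - Im z / 2 * a) * (Im z * b - Im z / 2 * b))
    with ((Im z / 2 * a) * (Im z / 2 * b)) by field.
  assert (0 < (Im z / 2 * a) * (Im z / 2 * b)).
  { repeat apply Rmult_lt_0_compat; lra. }
  lra.
Qed.

(** * Sign alternation on the bands *)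

(* Squares to z only on the closed upper half-plane. *)
Definition csqrt (z : C) : C :=
  (sqrt ((sqrt (Re z ^ 2 + Im z ^ 2) + Re z) / 2),
   sqrt ((sqrt (Re z ^ 2 + Im z ^ 2) - Re z) / 2)).

(** A branch of the square root of R on the upper half-plane, continuous up to the real axis. *)
Definition croot (E : nat -> R) (N : nat) (z : C) : C :=
  cprodn (fun m => csqrt (z - RtoC (E m))) N.

Lemma csqrt_sqr (z : C) : 0 <= Im z -> (csqrt z * csqrt z = z)%C.
Proof.
  destruct z as [a b]. unfold csqrt, Cmult, Re, Im; cbn [fst snd]. intros Hb.
  set (r := sqrt (a ^ 2 + b ^ 2)).
  assert (Hr0 : 0 <= r) by apply sqrt_pos.
  assert (Hr : r * r = a ^ 2 + b ^ 2).
  { apply sqrt_sqrt. generalize (pow2_ge_0 a) (pow2_ge_0 b). lra. }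
  assert (Ha : Rabs a <= r).
  { rewrite <- (sqrt_Rsqr_abs a). apply sqrt_le_1_alt. unfold Rsqr.
    generalize (pow2_ge_0 b). lra. }
  apply Rabs_le_between in Ha.
  assert (H1 : sqrt ((r + a) / 2) * sqrt ((r + a) / 2) = (r + a) / 2) by (apply sqrt_sqrt; lra).
  assert (H2 : sqrt ((r - a) / 2) * sqrt ((r - a) / 2) = (r - a) / 2) by (apply sqrt_sqrt; lra).
  assert (H3 : sqrt ((r + a) / 2) * sqrt ((r - a) / 2) = b / 2).
  { rewrite <- sqrt_mult by lra.
    replace ((r + a) / 2 * ((r - a) / 2)) with (Rsqr (b / 2)).
    - apply sqrt_Rsqr. lra.
    - unfold Rsqr. replace ((r + a) / 2 * ((r - a) / 2)) with ((r * r - a * a) / 4) by field.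
      rewrite Hr. field. }
  rewrite (Rmult_comm (sqrt ((r - a) / 2)) (sqrt ((r + a) / 2))), H1, H2, H3. f_equal; field.
Qed.

Lemma csqrt_real_pos (t : R) : 0 < t -> csqrt (RtoC t) = (sqrt t, 0).
Proof.
  intros Ht. unfold csqrt, RtoC, Re, Im; cbn [fst snd].
  replace (t ^ 2 + 0 ^ 2) with (Rsqr t) by (unfold Rsqr; ring).
  rewrite sqrt_Rsqr by lra. f_equal.
  - f_equal. field.
  - replace ((t - t) / 2) with 0 by field. apply sqrt_0.
Qed.

Lemma csqrt_real_neg (t : R) : t < 0 -> csqrt (RtoC t) = (0, sqrt (- t)).
Proof.
  intros Ht. unfold csqrt, RtoC, Re, Im; cbn [fst snd].
  replace (t ^ 2 + 0 ^ 2) with (Rsqr (- t)) by (unfold Rsqr; ring).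
  rewrite sqrt_Rsqr by lra. f_equal.
  - replace ((- t + t) / 2) with 0 by field. apply sqrt_0.
  - f_equal. field.
Qed.

Lemma croot_sqr (E : nat -> R) (N : nat) (z : C) :
  0 <= Im z -> (croot E N z * croot E N z = cprodn (fun m => z - RtoC (E m)) N)%C.
Proof.
  intros Hz. unfold croot. induction N as [|N IH]; simpl; [ring|].
  rewrite <- IH. rewrite <- (csqrt_sqr (z - RtoC (E N))%C) at 3.
  - ring.
  - destruct z; simpl in *. lra.
Qed.

Lemma croot_neq0 (E : nat -> R) (N : nat) (z : C) : 0 < Im z -> croot E N z <> RtoC 0.
Proof.
  intros Hz. unfold croot. induction N as [|N IH]; simpl.
  - intros H. injection H. lra.
  - apply Cmult_neq_0; [easy|]. intros H.
    assert (Hq := csqrt_sqr (z - RtoC (E N))%C).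
    rewrite H, Cmult_0_l in Hq.
    assert (Him : Im (z - RtoC (E N))%C = Im z) by (destruct z; simpl; ring).
    specialize (Hq ltac:(lra)). rewrite <- Hq in Him. simpl in Him. lra.
Qed.

(** Each pair of imaginary factors contributes -1. From one band to the next two branch points
    change sides, which flips the sign of Im s. *)
Lemma cprodn_band (F : nat -> C) (k i : nat) :
  (forall m, (m < k)%nat -> exists r, 0 < r /\ F m = (r, 0)) ->
  (forall m, (k <= m < k + 2 * i + 1)%nat -> exists r, 0 < r /\ F m = (0, r)) ->
  exists r, 0 < r /\ cprodn F (k + 2 * i + 1) = (0, (-1) ^ i * r).
Proof.
  intros H1 H2.
  assert (A : exists r, 0 < r /\ cprodn F k = (r, 0)).
  { clear H2. induction k as [|k IH]; simpl.
    - exists 1. split; [lra | easy].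
    - destruct IH as [r [Hr Er]]; [intros; apply H1; lia|].
      destruct (H1 k) as [s [Hs Es]]; [lia|].
      exists (r * s). split; [now apply Rmult_lt_0_compat|].
      rewrite Er, Es. unfold Cmult; simpl. f_equal; ring. }
  assert (B : exists r, 0 < r /\ cprodn F (k + 2 * i) = ((-1) ^ i * r, 0)).
  { assert (H3 : forall m, (k <= m < k + 2 * i)%nat -> exists r, 0 < r /\ F m = (0, r))
      by (intros; apply H2; lia).
    clear H2. induction i as [|i IH].
    - destruct A as [r [Hr Er]]. exists r. rewrite Nat.add_0_r, Er.
      split; [easy|]. simpl. f_equal. ring.
    - destruct IH as [r [Hr Er]]; [intros; apply H3; lia|].
      destruct (H3 (k + 2 * i)%nat) as [s [Hs Es]]; [lia|].
      destruct (H3 (S (k + 2 * i))) as [t [Ht Et]]; [lia|].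
      exists (r * (s * t)). split; [repeat apply Rmult_lt_0_compat; easy|].
      replace (k + 2 * S i)%nat with (S (S (k + 2 * i))) by lia.
      simpl cprodn. simpl in Er, Es, Et. rewrite Er, Es, Et. unfold Cmult; simpl. f_equal; ring. }
  destruct B as [r [Hr Er]]. destruct (H2 (k + 2 * i)%nat) as [s [Hs Es]]; [lia|].
  exists (r * s). split; [now apply Rmult_lt_0_compat|].
  rewrite Nat.add_1_r. simpl cprodn. simpl in Er, Es. rewrite Er, Es.
  unfold Cmult; simpl. f_equal; ring.
Qed.

Lemma increasing_le (E : nat -> R) (N : nat) :
  (forall m, (m < N)%nat -> E m < E (S m)) ->
  forall i j, (i <= j <= N)%nat -> E i <= E j.
Proof.
  intros H i j [Hij Hj]. induction Hij as [|j Hij IH]; [lra|].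
  generalize (IH ltac:(lia)) (H j ltac:(lia)). lra.
Qed.

Lemma croot_band (E : nat -> R) (n j : nat) (t : R) :
  (forall m, (m < 2 * n + 1)%nat -> E m < E (S m)) -> (j <= n)%nat ->
  E (2 * j)%nat < t < E (2 * j + 1)%nat ->
  exists r, 0 < r /\ croot E (2 * n + 2) (RtoC t) = (0, (-1) ^ (n - j) * r).
Proof.
  intros Hinc Hj Ht. unfold croot.
  (* There are 2j + 1 branch points to the left of [t] and 2(n - j) + 1 to the right. *)
  replace (2 * n + 2)%nat with (2 * j + 1 + 2 * (n - j) + 1)%nat by lia.
  assert (Hle := increasing_le E (2 * n + 1) Hinc).
  apply cprodn_band.
  - intros m Hm. rewrite <- RtoC_minus.
    assert (0 < t - E m) by (generalize (Hle m (2 * j)%nat ltac:(lia)); lra).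
    exists (sqrt (t - E m)). split; [now apply sqrt_lt_R0 | now apply csqrt_real_pos].
  - intros m Hm. rewrite <- RtoC_minus.
    assert (t - E m < 0) by (generalize (Hle (2 * j + 1)%nat m ltac:(lia)); lra).
    exists (sqrt (- (t - E m))). split; [apply sqrt_lt_R0; lra | now apply csqrt_real_neg].
Qed.

Definition ccont (Z : R -> C) : Prop :=
  forall t, continuous (fun s => Re (Z s)) t /\ continuous (fun s => Im (Z s)) t.

Lemma continuous_Rplus (v w : R -> R) (t : R) :
  continuous v t -> continuous w t -> continuous (fun s => v s + w s) t.
Proof. apply (continuous_plus v w). Qed.

Lemma continuous_Rminus (v w : R -> R) (t : R) :
  continuous v t -> continuous w t -> continuous (fun s => v s - w s) t.
Proof. apply (continuous_minus v w). Qed.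

Lemma continuous_Rmult (v w : R -> R) (t : R) :
  continuous v t -> continuous w t -> continuous (fun s => v s * w s) t.
Proof. apply (continuous_mult v w). Qed.

Lemma continuous_sqr (v : R -> R) (t : R) :
  continuous v t -> continuous (fun s => v s ^ 2) t.
Proof.
  intros H. apply (continuous_ext (fun s => v s * v s)).
  - intros s. simpl. now rewrite Rmult_1_r.
  - now apply continuous_Rmult.
Qed.

Lemma ccont_const (c : C) : ccont (fun _ => c).
Proof. intros t. split; apply continuous_const. Qed.

Lemma ccont_plus (Z W : R -> C) : ccont Z -> ccont W -> ccont (fun t => (Z t + W t)%C).
Proof.
  intros HZ HW t. destruct (HZ t), (HW t). split; now apply continuous_Rplus.
Qed.

Lemma ccont_minus (Z W : R -> C) : ccont Z -> ccont W -> ccont (fun t => (Z t - W t)%C).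
Proof.
  intros HZ HW t. destruct (HZ t), (HW t). split; now apply continuous_Rminus.
Qed.

Lemma ccont_mult (Z W : R -> C) : ccont Z -> ccont W -> ccont (fun t => (Z t * W t)%C).
Proof.
  intros HZ HW t. destruct (HZ t), (HW t).
  split; [apply continuous_Rminus | apply continuous_Rplus]; now apply continuous_Rmult.
Qed.

Lemma ccont_conj (Z : R -> C) : ccont Z -> ccont (fun t => Cconj (Z t)).
Proof.
  intros HZ t. destruct (HZ t) as [A B]. split; [easy | now apply (continuous_opp (fun s => Im (Z s)))].
Qed.

Lemma continuous_sqrt_comp (v : R -> R) (t : R) :
  continuous v t -> continuous (fun s => sqrt (v s)) t.
Proof.
  intros H. apply (continuous_comp v sqrt); [easy | apply continuous_sqrt].
Qed.

Lemma ccont_csqrt (Z : R -> C) : ccont Z -> ccont (fun t => csqrt (Z t)).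
Proof.
  intros HZ t. destruct (HZ t) as [A B].
  assert (D : continuous (fun s => sqrt (Re (Z s) ^ 2 + Im (Z s) ^ 2)) t).
  { apply continuous_sqrt_comp, continuous_Rplus; now apply continuous_sqr. }
  split; apply continuous_sqrt_comp; unfold Rdiv; apply continuous_Rmult;
    try apply continuous_const; [now apply continuous_Rplus | now apply continuous_Rminus].
Qed.

Lemma ccont_croot (E : nat -> R) (N : nat) (Z : R -> C) :
  ccont Z -> ccont (fun t => croot E N (Z t)).
Proof.
  intros HZ. unfold croot. induction N as [|N IH]; simpl; [apply ccont_const|].
  apply ccont_mult; [easy|]. apply ccont_csqrt, ccont_minus; [easy | apply ccont_const].
Qed.

Lemma ccont_cev (n : nat) (a : nat -> R) (Z : R -> C) :
  ccont Z -> ccont (fun t => cev n (Z t) a).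
Proof.
  intros HZ.
  assert (Hp : forall l, ccont (fun t => Cpow (Z t) l)).
  { induction l as [|l IH]; simpl; [apply ccont_const | now apply ccont_mult]. }
  assert (Hs : forall (v : nat -> R -> R) (N : nat) (t : R), (forall l, continuous (v l) t) ->
     continuous (fun s => sum_f_R0 (fun l => v l s) N) t).
  { intros v N t Hv. induction N as [|N IH]; simpl; [apply Hv|]. now apply continuous_Rplus. }
  intros t. split.
  - apply (Hs (fun l s => a (n - l)%nat * Re (Cpow (Z s) l))). intros l.
    apply continuous_Rmult; [apply continuous_const | apply Hp].
  - apply (Hs (fun l s => a (n - l)%nat * Im (Cpow (Z s) l))). intros l.
    apply continuous_Rmult; [apply continuous_const | apply Hp].
Qed.

Lemma cev_real (n : nat) (t : R) (a : nat -> R) :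
  cev n (RtoC t) a = RtoC (ev n (fun l => t ^ l) a).
Proof.
  assert (Hp : forall l, Cpow (RtoC t) l = RtoC (t ^ l)).
  { induction l as [|l IH]; simpl; [easy|]. now rewrite IH, RtoC_mult. }
  unfold cev, ev, RtoC at 3. f_equal.
  - apply sum_eq. intros l _. now rewrite Hp.
  - rewrite (sum_eq _ (fun _ => 0)).
    + clear. induction n as [|n IH]; simpl; lra.
    + intros l _. rewrite Hp. simpl. ring.
Qed.

Lemma nonvanishing_same_sign (v : R -> R) (a b : R) :
  a < b -> (forall t, continuous v t) -> (forall t, a <= t <= b -> v t <> 0) ->
  0 < v a * v b.
Proof.
  intros Hab Hc Hn. apply Rnot_le_lt. intros Hle.
  destruct (IVT_cor v a b) as [t [Ht H0]]; [|lra|easy|now apply (Hn t)].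
  intros t. apply continuity_pt_filterlim, Hc.
Qed.

(* The energy does not vanish along an arc in the upper half-plane joining two
   neighbouring bands; at its ends it equals Im(s) F, and Im(s) alternates. *)
Lemma sign_alternation (n : nat) (w : R -> R) (f g h dg : nat -> R -> R) (E : nat -> R)
  (j : nat) (x t1 t2 : R) :
  zero_curvature n w f g h dg ->
  (forall x t : R, t ^ 2 * ev n (fun l => t ^ l) (fun l => g l x) ^ 2
     + t * ev n (fun l => t ^ l) (fun l => f l x) * ev n (fun l => t ^ l) (fun l => h l x)
     = prodn (fun m => t - E m) (2 * n + 2)) ->
  (forall m, (m < 2 * n + 1)%nat -> E m < E (S m)) -> (S j <= n)%nat ->
  (forall t, (E (2 * j)%nat < t < E (2 * j + 1)%nat
     \/ E (2 * S j)%nat < t < E (2 * S j + 1)%nat) ->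
     ev n (fun l => t ^ l) (fun l => f l x) <> 0) ->
  E (2 * j)%nat < t1 < E (2 * j + 1)%nat ->
  E (2 * S j)%nat < t2 < E (2 * S j + 1)%nat ->
  ev n (fun l => t1 ^ l) (fun l => f l x) * ev n (fun l => t2 ^ l) (fun l => f l x) < 0.
Proof.
  intros Z HR Hinc Hj Hnz Ht1 Ht2.
  assert (Hgap : E (2 * j + 1)%nat < E (2 * S j)%nat).
  { replace (2 * S j)%nat with (S (2 * j + 1)) by lia. apply Hinc. lia. }
  assert (H12 : t1 < t2) by lra.
  set (z := fun t => (t, (t - t1) * (t2 - t)) : C).
  set (s := fun t => croot E (2 * n + 2) (z t)).
  set (F := fun t => cev n (z t) (fun l => f l x)).
  set (v := fun t => Im ((z t * cev n (z t) (fun l => g l x) + s t) * Cconj (F t))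
              - Im (z t) * (Re (F t) ^ 2 + Im (F t) ^ 2)).
  assert (Cz : ccont z).
  { intros t. split; unfold z; simpl.
    - apply continuous_id.
    - apply continuous_Rmult; apply continuous_Rminus;
        auto using continuous_const; apply continuous_id. }
  assert (CF : ccont F) by now apply ccont_cev.
  assert (Cv : forall t, continuous v t).
  { intros t. apply continuous_Rminus.
    - refine (proj2 (ccont_mult _ _ (ccont_plus _ _ (ccont_mult _ _ Cz _) _) _ t)).
      + now apply ccont_cev.
      + now apply ccont_croot.
      + now apply ccont_conj.
    - apply continuous_Rmult; [apply Cz|].
      destruct (CF t). apply continuous_Rplus; now apply continuous_sqr. }
  assert (Hend : forall i t, (i <= n)%nat -> (t = t1 \/ t = t2) ->
    E (2 * i)%nat < t < E (2 * i + 1)%nat -> exists r, 0 < r /\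
    v t = (-1) ^ (n - i) * r * ev n (fun l => t ^ l) (fun l => f l x)).
  { intros i t Hi Ht Hb.
    destruct (croot_band E n i t Hinc Hi Hb) as [r [Hr Er]]. exists r. split; [easy|].
    assert (Ez : z t = RtoC t).
    { unfold z, RtoC. f_equal. destruct Ht; subst; ring. }
    unfold v, s, F. rewrite Ez, Er, !cev_real. unfold RtoC, Cmult, Cplus, Cconj, Re, Im.
    simpl. ring. }
  destruct (Hend j t1) as [r1 [Hr1 E1]]; [lia|now left|easy|].
  destruct (Hend (S j) t2) as [r2 [Hr2 E2]]; [lia|now right|easy|].
  assert (Hpow : forall i, (-1) ^ i <> 0) by (intros; apply pow_nonzero; lra).
  assert (Hsgn : 0 < v t1 * v t2).
  { apply nonvanishing_same_sign; [easy..|]. intros t Ht.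
    destruct (Req_dec t t1) as [->|N1].
    { rewrite E1. repeat apply Rmult_integral_contrapositive_currified; auto; lra. }
    destruct (Req_dec t t2) as [->|N2].
    { rewrite E2. repeat apply Rmult_integral_contrapositive_currified; auto; lra. }
    assert (Him : 0 < Im (z t)) by (unfold z; simpl; apply Rmult_lt_0_compat; lra).
    apply (energy_nonzero n w f g h dg (z t) (s t) Z Him).
    - now apply croot_neq0.
    - intros y. unfold s. rewrite croot_sqr by lra.
      apply curve_identity_complex. intros r. apply HR. }
  rewrite E1, E2 in Hsgn.
  replace (n - j)%nat with (S (n - S j)) in Hsgn by lia. simpl in Hsgn.
  set (e := (-1) ^ (n - S j)) in *.
  set (A := ev n (fun l => t1 ^ l) (fun l => f l x)) in *.
  set (B := ev n (fun l => t2 ^ l) (fun l => f l x)) in *.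
  apply Rnot_le_lt. intros Hle.
  assert (Hc : 0 <= e * e * (r1 * r2) * (A * B)).
  { apply Rmult_le_pos; [|easy].
    apply Rmult_le_pos; [apply Rle_0_sqr | left; now apply Rmult_lt_0_compat]. }
  lra.
Qed.

Lemma cprodn_real (F : nat -> R) (N : nat) :
  cprodn (fun m => RtoC (F m)) N = RtoC (prodn F N).
Proof.
  induction N as [|N IH]; simpl; [easy|]. now rewrite IH, RtoC_mult.
Qed.

Lemma cprodn_ext (F G : nat -> C) (N : nat) :
  (forall m, F m = G m) -> cprodn F N = cprodn G N.
Proof.
  intros H. induction N as [|N IH]; simpl; [easy|]. now rewrite IH, H.
Qed.

(** R is the square of [croot], which is purely imaginary and nonzero on a band. *)
Lemma prodn_band_neg (E : nat -> R) (n j : nat) (t : R) :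
  (forall m, (m < 2 * n + 1)%nat -> E m < E (S m)) -> (j <= n)%nat ->
  E (2 * j)%nat < t < E (2 * j + 1)%nat ->
  prodn (fun m => t - E m) (2 * n + 2) < 0.
Proof.
  intros Hinc Hj Ht. destruct (croot_band E n j t Hinc Hj Ht) as [r [Hr Er]].
  assert (H := croot_sqr E (2 * n + 2) (RtoC t) ltac:(simpl; lra)).
  rewrite Er, (cprodn_ext _ (fun m => RtoC (t - E m))), cprodn_real in H
    by (intros; now rewrite RtoC_minus).
  apply (f_equal Re) in H. unfold Cmult, RtoC, Re in H. cbn [fst snd] in H. rewrite <- H.
  assert (0 < ((-1) ^ (n - j) * r) * ((-1) ^ (n - j) * r)).
  { apply Rsqr_pos_lt. apply Rmult_integral_contrapositive_currified; [|lra].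
    apply pow_nonzero; lra. }
  lra.
Qed.

(** * Zeros of polynomials with sign changes *)

Lemma prodn_ext (F G : nat -> R) (N : nat) :
  (forall m, (m < N)%nat -> F m = G m) -> prodn F N = prodn G N.
Proof.
  induction N as [|N IH]; simpl; intros H; [easy|].
  rewrite IH, H; [easy | lia | intros; apply H; lia].
Qed.

Lemma synthetic_division (n : nat) (c : nat -> R) (r : R) :
  exists q : nat -> R,
    (forall t, sum_f_R0 (fun l => c l * t ^ l) (S n)
       = (t - r) * sum_f_R0 (fun l => q l * t ^ l) n + sum_f_R0 (fun l => c l * r ^ l) (S n))
    /\ q n = c (S n).
Proof.
  revert c. induction n as [|n IH]; intros c.
  - exists (fun _ => c 1%nat). split; [|easy]. intros t. simpl. ring.
  - destruct (IH (fun l => c (S l))) as [q [Hq Hl]].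
    set (v := sum_f_R0 (fun l => c (S l) * r ^ l) (S n)) in *.
    exists (fun l => match l with O => v | S l => q l end). split; [|easy].
    assert (Hs : forall (a : nat -> R) m t, sum_f_R0 (fun l => a l * t ^ l) (S m)
      = a 0%nat + t * sum_f_R0 (fun l => a (S l) * t ^ l) m).
    { intros a m t. rewrite decomp_sum by lia. simpl pred.
      rewrite scal_sum. simpl pow at 1. rewrite Rmult_1_r. f_equal.
      apply sum_eq. intros l _. simpl. ring. }
    intros t. rewrite (Hs c (S n) t), (Hs c (S n) r), Hq.
    rewrite (Hs (fun l => match l with O => v | S l => q l end) n t). fold v. ring.
Qed.

Lemma factor_distinct_roots (n : nat) (c r : nat -> R) :
  (forall i, (i < n)%nat -> sum_f_R0 (fun l => c l * r i ^ l) n = 0) ->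
  (forall i j, (i < j < n)%nat -> r i <> r j) ->
  forall t, sum_f_R0 (fun l => c l * t ^ l) n = c n * prodn (fun i => t - r i) n.
Proof.
  revert c. induction n as [|n IH]; intros c Hr Hd t.
  - simpl. ring.
  - destruct (synthetic_division n c (r n)) as [q [Hq Hl]].
    rewrite Hq, (Hr n) by lia. simpl prodn. rewrite <- Hl, (IH q).
    + ring.
    + intros i Hi. assert (H := Hr i ltac:(lia)). rewrite Hq, (Hr n) in H by lia.
      rewrite Rplus_0_r in H. destruct (Rmult_integral _ _ H) as [H0|]; [|easy].
      exfalso. apply (Hd i n ltac:(lia)). lra.
    + intros i j Hij. apply Hd. lia.
Qed.

Lemma ev_continuous (n : nat) (a : nat -> R) (t : R) :
  continuous (fun s => ev n (fun l => s ^ l) a) t.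
Proof.
  destruct (ccont_cev n a (fun s => RtoC s)) with (t := t) as [H _].
  - intros s. split; simpl; [apply continuous_id | apply continuous_const].
  - apply (continuous_ext _ _ t (fun s => f_equal Re (cev_real n s a))), H.
Qed.

(** The sign change between the midpoints of neighbouring bands gives a zero, which cannot lie in
    either open band. *)
Lemma root_in_gap (E : nat -> R) (n j : nat) (v : R -> R) :
  (forall t, continuous v t) ->
  (forall m, (m < 2 * n + 1)%nat -> E m < E (S m)) -> (S j <= n)%nat ->
  (forall i t, (i <= n)%nat -> E (2 * i)%nat < t < E (2 * i + 1)%nat -> v t <> 0) ->
  (forall t1 t2, E (2 * j)%nat < t1 < E (2 * j + 1)%nat ->
     E (2 * S j)%nat < t2 < E (2 * S j + 1)%nat -> v t1 * v t2 < 0) ->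
  exists r, E (2 * S j - 1)%nat <= r <= E (2 * S j)%nat /\ v r = 0.
Proof.
  intros Hc Hinc Hj Hnz Hsg.
  assert (B1 : E (2 * j)%nat < E (2 * j + 1)%nat).
  { rewrite Nat.add_1_r. apply Hinc. lia. }
  assert (B2 : E (2 * S j)%nat < E (2 * S j + 1)%nat).
  { rewrite Nat.add_1_r. apply Hinc. lia. }
  assert (Hgap : E (2 * j + 1)%nat < E (2 * S j)%nat).
  { replace (2 * S j)%nat with (S (2 * j + 1)) by lia. apply Hinc. lia. }
  set (t1 := (E (2 * j)%nat + E (2 * j + 1)%nat) / 2).
  set (t2 := (E (2 * S j)%nat + E (2 * S j + 1)%nat) / 2).
  destruct (IVT_cor v t1 t2) as [r [Hr H0]].
  - intros t. apply continuity_pt_filterlim, Hc.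
  - unfold t1, t2. lra.
  - left. apply Hsg; unfold t1, t2; lra.
  - exists r. split; [|easy]. replace (2 * S j - 1)%nat with (2 * j + 1)%nat by lia.
    split; apply Rnot_lt_le; intros Hlt.
    + apply (Hnz j r ltac:(lia)); [unfold t1 in Hr; lra | easy].
    + apply (Hnz (S j) r ltac:(lia)); [unfold t2 in Hr; lra | easy].
Qed.

Lemma roots_in_gaps (E : nat -> R) (n : nat) (a : nat -> R) :
  (forall m, (m < 2 * n + 1)%nat -> E m < E (S m)) ->
  (forall i t, (i <= n)%nat -> E (2 * i)%nat < t < E (2 * i + 1)%nat ->
     ev n (fun l => t ^ l) a <> 0) ->
  (forall j t1 t2, (S j <= n)%nat -> E (2 * j)%nat < t1 < E (2 * j + 1)%nat ->
     E (2 * S j)%nat < t2 < E (2 * S j + 1)%nat ->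
     ev n (fun l => t1 ^ l) a * ev n (fun l => t2 ^ l) a < 0) ->
  exists r : nat -> R,
    (forall j, (1 <= j <= n)%nat -> E (2 * j - 1)%nat <= r j <= E (2 * j)%nat)
    /\ (forall t, ev n (fun l => t ^ l) a = a O * prodn (fun j => t - r (S j)) n).
Proof.
  intros Hinc Hnz Hsg.
  (* Outside 1..n the value 0 only makes the choice total. *)
  assert (H : forall j, exists r, (1 <= j <= n)%nat ->
    E (2 * j - 1)%nat <= r <= E (2 * j)%nat /\ ev n (fun l => r ^ l) a = 0).
  { intros [|j]; [exists 0; lia|].
    destruct (Nat.le_gt_cases (S j) n) as [Hj|Hj]; [|exists 0; lia].
    destruct (root_in_gap E n j (fun t => ev n (fun l => t ^ l) a) (ev_continuous n a)
      Hinc Hj Hnz (fun t1 t2 => Hsg j t1 t2 Hj)) as [r Hr].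
    now exists r. }
  set (r := fun j => proj1_sig (constructive_indefinite_description _ (H j))).
  assert (Hr : forall j, (1 <= j <= n)%nat ->
    E (2 * j - 1)%nat <= r j <= E (2 * j)%nat /\ ev n (fun l => r j ^ l) a = 0).
  { intros j. unfold r. destruct (constructive_indefinite_description _ (H j)). easy. }
  exists r. split; [intros; now apply Hr|].
  intros t. unfold ev.
  rewrite (factor_distinct_roots n (fun l => a (n - l)%nat) (fun j => r (S j))).
  - now rewrite Nat.sub_diag.
  - intros i Hi. apply (Hr (S i)). lia.
  - intros i j Hij.
    assert (A := proj1 (Hr (S i) ltac:(lia))). assert (B := proj1 (Hr (S j) ltac:(lia))).
    assert (E (2 * S i)%nat < E (S (2 * S i))) by (apply Hinc; lia).
    assert (E (S (2 * S i)) <= E (2 * S j - 1)%nat).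
    { apply (increasing_le E (2 * n + 1) Hinc). lia. }
    lra.
Qed.

(** * Smoothness of the zeros and the Dubrovin equations *)

(** The zeros are numbered from 1 and [prodn] from 0, hence [S i]; a factor 1 in place of the
    dropped one keeps the length of the product. *)
Definition omit (j : nat) (F : nat -> R) (i : nat) : R :=
  if Nat.eqb (S i) j then 1 else F i.

Lemma prodn_omit (F : nat -> R) (N i : nat) :
  (i < N)%nat -> prodn F N = F i * prodn (omit (S i) F) N.
Proof.
  induction N as [|N IH]; [lia|]. intros Hi. simpl.
  destruct (Nat.eq_dec i N) as [->|Hn].
  - unfold omit at 2. rewrite Nat.eqb_refl.
    rewrite (prodn_ext (omit (S N) F) F N); [ring|].
    intros m Hm. unfold omit. destruct (Nat.eqb_spec (S m) (S N)); [lia | easy].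
  - rewrite IH by lia. unfold omit at 3.
    destruct (Nat.eqb_spec (S N) (S i)); [lia | ring].
Qed.

Lemma prodn_omit_inv (F : nat -> R) (N j : nat) :
  prodn (omit j (fun i => / F i)) N = / prodn (omit j F) N.
Proof.
  induction N as [|N IH]; simpl; [now rewrite Rinv_1|].
  rewrite IH, Rinv_mult. f_equal. unfold omit. destruct (Nat.eqb _ _); [now rewrite Rinv_1 | easy].
Qed.

Lemma prodn_lower_bound (F : nat -> R) (N : nat) (d : R) :
  0 < d -> (forall i, (i < N)%nat -> d <= Rabs (F i)) -> d ^ N <= Rabs (prodn F N).
Proof.
  intros Hd. induction N as [|N IH]; simpl; intros H; [rewrite Rabs_R1; lra|].
  rewrite Rabs_mult, Rmult_comm.
  apply Rmult_le_compat; [apply pow_le; lra | lra | apply IH; intros; apply H; lia | apply H; lia].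
Qed.

Lemma prodn_neq0 (F : nat -> R) (N : nat) :
  (forall i, (i < N)%nat -> F i <> 0) -> prodn F N <> 0.
Proof.
  induction N as [|N IH]; simpl; intros H; [lra|].
  apply Rmult_integral_contrapositive_currified; [apply IH; intros; apply H; lia | apply H; lia].
Qed.

Lemma prodn_continuous (F : nat -> R -> R) (N : nat) (x : R) :
  (forall i, (i < N)%nat -> continuous (F i) x) ->
  continuous (fun t => prodn (fun i => F i t) N) x.
Proof.
  induction N as [|N IH]; simpl; intros H; [apply continuous_const|].
  apply continuous_Rmult; [apply IH; intros; apply H; lia | apply H; lia].
Qed.

Lemma omit_continuous (j : nat) (F : nat -> R -> R) (N : nat) (x : R) :
  (forall i, (i < N)%nat -> S i <> j -> continuous (F i) x) ->
  continuous (fun t => prodn (omit j (fun i => F i t)) N) x.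
Proof.
  intros H. apply (prodn_continuous (fun i t => omit j (fun i => F i t) i)).
  intros i Hi. unfold omit. destruct (Nat.eqb_spec (S i) j); [apply continuous_const|].
  now apply H.
Qed.

(** A product rule for a second factor that is merely continuous. It lets the zeros be
    differentiated while only their continuity is known. *)
Lemma is_derive_vanishing_mult (p k : R -> R) (x dp : R) :
  is_derive p x dp -> p x = 0 -> continuous k x ->
  is_derive (fun t => p t * k t) x (dp * k x).
Proof.
  intros Hp H0 Hk. apply is_derive_Reals.
  assert (Hp' := proj1 (is_derive_Reals _ _ _) Hp).
  set (q := fun h => (p (x + h) - p x) / h).
  assert (Lq : is_lim q 0 dp).
  { apply is_lim_spec. intros e. destruct (Hp' e (cond_pos e)) as [del Hdel].
    exists del. intros h Hh Hn. apply Hdel; [easy|].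
    unfold ball in Hh; simpl in Hh. unfold AbsRing_ball, abs, minus, plus, opp in Hh.
    simpl in Hh. now rewrite Ropp_0, Rplus_0_r in Hh. }
  assert (Lk : is_lim (fun h => k (x + h)) 0 (k x)).
  { apply is_lim_spec. intros e.
    destruct (Hk _ (locally_ball (k x) e)) as [del Hdel]. exists del. intros h Hh _.
    apply (Hdel (x + h)). revert Hh.
    unfold ball; simpl. unfold AbsRing_ball, abs, minus, plus, opp. simpl.
    rewrite Ropp_0, Rplus_0_r. intros Hh. now rewrite (Rplus_minus_l x h : x + h + - x = h). }
  assert (L := is_lim_mult _ _ _ _ _ Lq Lk I). apply is_lim_spec in L. simpl in L.
  intros e He. destruct (L (mkposreal e He)) as [del Hdel]. exists del.
  intros h Hn Hh. simpl in Hdel.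
  replace ((p (x + h) * k (x + h) - p x * k x) / h) with (q h * k (x + h))
    by (unfold q; rewrite H0; field; easy).
  apply Hdel; [|easy].
  unfold ball; simpl. unfold AbsRing_ball, abs, minus, plus, opp. simpl.
  now rewrite Ropp_0, Rplus_0_r.
Qed.

Lemma min_step (E : nat -> R) (N : nat) :
  (forall m, (m < N)%nat -> E m < E (S m)) ->
  exists d, 0 < d <= 1 /\ forall m, (m < N)%nat -> d <= E (S m) - E m.
Proof.
  induction N as [|N IH]; intros H.
  - exists 1. split; [lra | lia].
  - destruct IH as [d [Hd Hm]]; [intros; apply H; lia|].
    assert (HN := H N ltac:(lia)).
    exists (Rmin d (E (S N) - E N)). split.
    + split; [apply Rmin_pos; lra | generalize (Rmin_l d (E (S N) - E N)); lra].
    + intros m Hm'. destruct (Nat.eq_dec m N) as [->|]; [apply Rmin_r|].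
      eapply Rle_trans; [apply Rmin_l | apply Hm; lia].
Qed.

(** The points [x] and [y] are independent because z will be frozen at mu_j(x0) while the other
    zeros move. *)
Lemma gaps_separated (E : nat -> R) (n : nat) (mu : nat -> R -> R) :
  (forall m, (m < 2 * n + 1)%nat -> E m < E (S m)) ->
  (forall j x, (1 <= j <= n)%nat -> E (2 * j - 1)%nat <= mu j x <= E (2 * j)%nat) ->
  exists d, 0 < d <= 1 /\ forall i j x y, (1 <= i <= n)%nat -> (1 <= j <= n)%nat ->
    i <> j -> d <= Rabs (mu i x - mu j y).
Proof.
  intros Hinc Hloc. destruct (min_step E (2 * n + 1) Hinc) as [d [Hd Hm]].
  exists d. split; [easy|].
  assert (Hlt : forall i j x y, (1 <= i <= n)%nat -> (1 <= j <= n)%nat -> (i < j)%nat ->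
    d <= mu j y - mu i x).
  { intros i j x y Hi Hj Hij.
    generalize (Hm (2 * i)%nat ltac:(lia)) (proj2 (Hloc i x Hi)) (proj1 (Hloc j y Hj))
      (increasing_le E (2 * n + 1) Hinc (S (2 * i)) (2 * j - 1) ltac:(lia)). lra. }
  intros i j x y Hi Hj Hn. destruct (Nat.lt_total i j) as [H|[H|H]]; [|easy|].
  - generalize (Hlt i j x y Hi Hj H) (Rle_abs (- (mu i x - mu j y))).
    rewrite Rabs_Ropp. lra.
  - generalize (Hlt j i y x Hj Hi H) (Rle_abs (mu i x - mu j y)). lra.
Qed.

(** At z = mu_j(x0), F is mu_j(x0) - mu_j(x) times a product of modulus at least [d ^ n], so the
    continuity of F in x controls mu_j. *)
Lemma zeros_continuous (n : nat) (w : R -> R) (f g h dg : nat -> R -> R) (E : nat -> R)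
  (mu : nat -> R -> R) (j : nat) (x0 : R) :
  zero_curvature n w f g h dg ->
  (forall m, (m < 2 * n + 1)%nat -> E m < E (S m)) ->
  (forall j x, (1 <= j <= n)%nat -> E (2 * j - 1)%nat <= mu j x <= E (2 * j)%nat) ->
  (forall x t, ev n (fun l => t ^ l) (fun l => f l x) = prodn (fun i => t - mu (S i) x) n) ->
  (1 <= j <= n)%nat -> continuous (mu j) x0.
Proof.
  intros Z Hinc Hloc HF Hj.
  destruct (gaps_separated E n mu Hinc Hloc) as [d [Hd Hsep]].
  set (p := fun x => ev n (fun l => mu j x0 ^ l) (fun l => f l x)).
  assert (Hfac : forall x, p x = (mu j x0 - mu j x)
     * prodn (omit j (fun i => mu j x0 - mu (S i) x)) n).
  { intros x. unfold p. rewrite HF, (prodn_omit _ n (j - 1)) by lia.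
    now replace (S (j - 1)) with j by lia. }
  assert (Hp0 : p x0 = 0) by (rewrite Hfac; ring).
  assert (Cp : continuous p x0).
  { apply (ex_derive_continuous p). eexists. apply (ev_is_derive_F n w f g h dg _ x0 Z). }
  assert (Hdn : 0 < d ^ n) by (apply pow_lt; lra).
  assert (Hlow : forall x, Rabs (mu j x - mu j x0) * d ^ n <= Rabs (p x)).
  { intros x. rewrite Hfac, Rabs_mult, Rabs_minus_sym.
    apply Rmult_le_compat_l; [apply Rabs_pos|].
    apply prodn_lower_bound; [lra|]. intros i Hi. unfold omit.
    (* The omitted factor is 1, which [d <= 1] covers. *)
    destruct (Nat.eqb_spec (S i) j); [rewrite Rabs_R1; lra | apply Hsep; lia]. }
  intros P [e HP].
  assert (He : 0 < e * d ^ n) by (apply Rmult_lt_0_compat; [apply cond_pos | easy]).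
  destruct (Cp _ (locally_ball (p x0) (mkposreal _ He))) as [del Hdel].
  exists del. intros x Hx. apply HP. specialize (Hdel x Hx). revert Hdel.
  unfold ball; simpl. unfold AbsRing_ball, abs, minus, plus, opp. simpl.
  rewrite Hp0, Ropp_0, Rplus_0_r. intros Hdel.
  apply (Rmult_lt_reg_r (d ^ n)); [easy|].
  generalize (Hlow x). unfold Rminus. lra.
Qed.

Lemma dubrovin (n : nat) (w : R -> R) (f g h dg : nat -> R -> R) (E : nat -> R)
  (mu : nat -> R -> R) (j : nat) (x0 : R) :
  zero_curvature n w f g h dg ->
  (forall m, (m < 2 * n + 1)%nat -> E m < E (S m)) ->
  (forall j x, (1 <= j <= n)%nat -> E (2 * j - 1)%nat <= mu j x <= E (2 * j)%nat) ->
  (forall x t, ev n (fun l => t ^ l) (fun l => f l x) = prodn (fun i => t - mu (S i) x) n) ->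
  (1 <= j <= n)%nat ->
  is_derive (mu j) x0 (-2 * ev n (fun l => mu j x0 ^ l) (fun l => g l x0)
    * prodn (omit j (fun i => / (mu j x0 - mu (S i) x0))) n).
Proof.
  intros Z Hinc Hloc HF Hj.
  destruct (gaps_separated E n mu Hinc Hloc) as [d [Hd Hsep]].
  set (p := fun x => ev n (fun l => mu j x0 ^ l) (fun l => f l x)).
  set (K := fun x => prodn (omit j (fun i => mu j x0 - mu (S i) x)) n).
  assert (Hfac : forall x, p x = (mu j x0 - mu j x) * K x).
  { intros x. unfold p, K. rewrite HF, (prodn_omit _ n (j - 1)) by lia.
    now replace (S (j - 1)) with j by lia. }
  assert (Hp0 : p x0 = 0) by (rewrite Hfac; ring).
  assert (HK : forall x, K x <> 0).
  { intros x. apply prodn_neq0. intros i Hi. unfold omit.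
    destruct (Nat.eqb_spec (S i) j); [lra|].
    intros H0. assert (H1 := Hsep j (S i) x0 x Hj ltac:(lia) ltac:(lia)).
    rewrite H0, Rabs_R0 in H1. lra. }
  assert (CK : continuous (fun x => / K x) x0).
  { apply (continuous_comp K Rinv); [|now apply continuous_Rinv].
    apply (omit_continuous j (fun i x => mu j x0 - mu (S i) x)). intros i Hi _.
    apply continuous_Rminus; [apply continuous_const|].
    apply (zeros_continuous n w f g h dg E mu); auto. lia. }
  (* The factorisation is solved for mu_j; since [p] vanishes at [x0], continuity of [K] there is
     enough. *)
  apply (is_derive_ext (fun x => mu j x0 - p x * / K x)).
  { intros x. rewrite Hfac. simpl. field. apply HK. }
  rewrite prodn_omit_inv. fold (K x0).
  eapply is_derive_eq.
  - apply @is_derive_minus; [apply @is_derive_const|].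
    apply is_derive_vanishing_mult; [|exact Hp0 | exact CK].
    apply (ev_is_derive_F n w f g h dg _ x0 Z).
  - unfold p in Hp0. rewrite Hp0.
    unfold minus, plus, opp, zero; simpl. ring.
Qed.

Lemma diffn_ev (n : nat) (a : nat -> R -> R) (v : R -> R) (k : nat) :
  (forall l, (l <= n)%nat -> diffn k (a l)) -> diffn k v ->
  diffn k (fun x => ev n (fun l => v x ^ l) (fun l => a l x)).
Proof.
  intros Ha Hv. apply (diffn_sum k (fun l x => a (n - l)%nat x * v x ^ l)).
  intros l Hl. apply diffn_mult; [apply Ha; lia | now apply diffn_pow].
Qed.

Lemma zeros_smooth (n : nat) (w : R -> R) (f g h dg : nat -> R -> R) (E : nat -> R)
  (mu : nat -> R -> R) :
  zero_curvature n w f g h dg ->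
  (forall m, (m < 2 * n + 1)%nat -> E m < E (S m)) ->
  (forall j x, (1 <= j <= n)%nat -> E (2 * j - 1)%nat <= mu j x <= E (2 * j)%nat) ->
  (forall x t, ev n (fun l => t ^ l) (fun l => f l x) = prodn (fun i => t - mu (S i) x) n) ->
  forall k j, (1 <= j <= n)%nat -> diffn k (mu j).
Proof.
  intros Z Hinc Hloc HF.
  destruct (gaps_separated E n mu Hinc Hloc) as [d [Hd Hsep]].
  induction k as [|k IH]; intros j Hj; [easy|].
  eexists. split; [intros x; now apply (dubrovin n w f g h dg E mu)|].
  apply diffn_mult; [apply diffn_scal, diffn_ev|].
  - intros l Hl. now apply (zc_smooth_g _ _ _ _ _ _ Z).
  - now apply IH.
  - apply (diffn_prodn k (fun i x => omit j (fun i => / (mu j x - mu (S i) x)) i)).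
    intros i Hi. unfold omit. destruct (Nat.eqb_spec (S i) j); [apply diffn_const|].
    apply (diffn_inv k (fun x => mu j x - mu (S i) x)).
    + intros x H0. assert (H1 := Hsep j (S i) x x Hj ltac:(lia) ltac:(lia)).
      rewrite H0, Rabs_R0 in H1. lra.
    + apply diffn_minus; apply IH; lia.
Qed.

Lemma ev_ex_derive (n : nat) (a : nat -> R) (t : R) :
  ex_derive (fun s => ev n (fun l => s ^ l) a) t.
Proof.
  eexists. apply (is_derive_sum (fun l s => a (n - l)%nat * s ^ l)
    (fun l s => a (n - l)%nat * (INR l * 1 * s ^ pred l))).
  intros l _. apply is_derive_scal, (is_derive_pow (fun s => s)), @is_derive_id.
Qed.

(* A common zero of F, G and H would be a double zero of the simple-rooted curve polynomial. *)
Lemma branch_point_H_neq0 (n e : nat) (f g h E : nat -> R) :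
  (forall t : R, t ^ 2 * ev n (fun l => t ^ l) g ^ 2
     + t * ev n (fun l => t ^ l) f * ev n (fun l => t ^ l) h
     = prodn (fun m => t - E m) (2 * n + 2)) ->
  (forall m, (m < 2 * n + 1)%nat -> E m < E (S m)) -> (e < 2 * n + 2)%nat ->
  ev n (fun l => E e ^ l) f = 0 -> ev n (fun l => E e ^ l) g = 0 ->
  ev n (fun l => E e ^ l) h <> 0.
Proof.
  intros HR Hinc He F0 G0 H0.
  set (F := fun t => ev n (fun l => t ^ l) f) in *.
  set (G := fun t => ev n (fun l => t ^ l) g) in *.
  set (H := fun t => ev n (fun l => t ^ l) h) in *.
  destruct (ev_ex_derive n f (E e)) as [dF HdF].
  destruct (ev_ex_derive n g (E e)) as [dG HdG].
  (* Both terms of R are products of factors vanishing at [E e]; [D2] computes the same derivative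
     as a product of nonzero differences. *)
  assert (D1 : is_derive (fun t => prodn (fun m => t - E m) (2 * n + 2)) (E e) 0).
  { assert (Hext : forall t : R, G t * (t * t * G t) + F t * (t * H t)
      = prodn (fun m => t - E m) (2 * n + 2)) by (intros t; rewrite <- HR; unfold F, G, H; ring).
    apply (is_derive_ext (fun t => G t * (t * t * G t) + F t * (t * H t)) _ _ _ Hext).
    eapply is_derive_eq.
    - apply @is_derive_plus; apply is_derive_vanishing_mult;
        [exact HdG | exact G0 | | exact HdF | exact F0 |].
      + repeat apply continuous_Rmult; try apply continuous_id. apply ev_continuous.
      + apply continuous_Rmult; [apply continuous_id | apply ev_continuous].
    - change (G (E e) = 0) in G0. change (H (E e) = 0) in H0. unfold plus; simpl.
      rewrite G0, H0. ring. }
  assert (D2 : is_derive (fun t => prodn (fun m => t - E m) (2 * n + 2)) (E e)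
    (1 * prodn (omit (S e) (fun m => E e - E m)) (2 * n + 2))).
  { apply (is_derive_ext (fun t => (t - E e) * prodn (omit (S e) (fun m => t - E m)) (2 * n + 2))).
    { intros t. symmetry. now apply (prodn_omit (fun m => t - E m)). }
    apply (is_derive_vanishing_mult (fun t => t - E e)
      (fun t => prodn (omit (S e) (fun m => t - E m)) (2 * n + 2))).
    - auto_derive; [easy | ring].
    - ring.
    - apply (omit_continuous (S e) (fun m t => t - E m)). intros i _ _.
      apply continuous_Rminus; [apply continuous_id | apply continuous_const]. }
  assert (Heq := is_derive_unique _ _ _ D1). rewrite (is_derive_unique _ _ _ D2), Rmult_1_l in Heq.
  revert Heq. apply prodn_neq0. intros i Hi. unfold omit.
  destruct (Nat.eqb_spec (S i) (S e)); [lra|].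
  assert (Hlt : forall a b, (a < b)%nat -> (b < 2 * n + 2)%nat -> E a < E b).
  { intros a b Hab Hb. generalize (Hinc a ltac:(lia))
      (increasing_le E (2 * n + 1) Hinc (S a) b ltac:(lia)). lra. }
  destruct (Nat.lt_total i e) as [Hie|[Hie|Hie]]; [|lia|].
  - generalize (Hlt i e Hie He). lra.
  - generalize (Hlt e i Hie Hi). lra.
Qed.

Lemma is_derive_pow_critical (v : R -> R) (x : R) (l : nat) :
  is_derive v x 0 -> is_derive (fun t => v t ^ l) x 0.
Proof.
  intros H. eapply is_derive_eq; [apply (is_derive_pow v l x 0 H) | ring].
Qed.

Lemma sheet_change (n e j : nat) (w : R -> R) (f g h dg : nat -> R -> R) (E : nat -> R)
  (mu : nat -> R -> R) (x0 : R) :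
  zero_curvature n w f g h dg ->
  (forall x t : R, t ^ 2 * ev n (fun l => t ^ l) (fun l => g l x) ^ 2
     + t * ev n (fun l => t ^ l) (fun l => f l x) * ev n (fun l => t ^ l) (fun l => h l x)
     = prodn (fun m => t - E m) (2 * n + 2)) ->
  (forall m, (m < 2 * n + 1)%nat -> E m < E (S m)) ->
  (forall j x, (1 <= j <= n)%nat -> E (2 * j - 1)%nat <= mu j x <= E (2 * j)%nat) ->
  (forall x t, ev n (fun l => t ^ l) (fun l => f l x) = prodn (fun i => t - mu (S i) x) n) ->
  (1 <= j <= n)%nat -> (e < 2 * n + 2)%nat -> mu j x0 = E e -> E e <> 0 ->
  exists delta : R, 0 < delta /\
    forall x1 x2 : R, x0 - delta < x1 < x0 -> x0 < x2 < x0 + delta ->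
      (- mu j x1 * ev n (fun l => mu j x1 ^ l) (fun l => g l x1))
      * (- mu j x2 * ev n (fun l => mu j x2 ^ l) (fun l => g l x2)) < 0.
Proof.
  intros Z HR Hinc Hloc HF Hj He Hmu Hne.
  assert (F0 : ev n (fun l => E e ^ l) (fun l => f l x0) = 0).
  { rewrite HF, (prodn_omit _ n (j - 1)) by lia.
    replace (S (j - 1)) with j by lia. rewrite Hmu. ring. }
  assert (G0 : ev n (fun l => E e ^ l) (fun l => g l x0) = 0).
  (* R and F vanish here, so (zG)^2 = 0, and z is nonzero. *)
  { assert (H := HR x0 (E e)). rewrite F0, (prodn_omit _ _ e He) in H.
    assert (H1 : (E e * ev n (fun l => E e ^ l) (fun l => g l x0)) ^ 2 = 0) by lra.
    assert (H2 : E e * ev n (fun l => E e ^ l) (fun l => g l x0) = 0).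
    { apply Rsqr_0_uniq. unfold Rsqr. lra. }
    destruct (Rmult_integral _ _ H2); [easy | easy]. }
  assert (H0 := branch_point_H_neq0 n e _ _ _ E (HR x0) Hinc He F0 G0).
  assert (Dmu : is_derive (mu j) x0 0).
  { eapply is_derive_eq; [now apply (dubrovin n w f g h dg E mu)|].
    rewrite Hmu, G0. ring. }
  set (y := fun x => - mu j x * ev n (fun l => mu j x ^ l) (fun l => g l x)).
  (* Since mu_j is critical at [x0], only the coefficients of zG are differentiated: the result is
     -(zG)_x = H - wF, and F = 0. *)
  assert (Dy : is_derive y x0 (ev n (fun l => E e ^ l) (fun l => h l x0))).
  { apply (is_derive_ext (fun x => -1 * sum_f_R0 (fun l => g (n - l)%nat x * mu j x ^ S l) n)).
    { intros x. unfold y, ev.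
      replace (- mu j x * sum_f_R0 (fun l => g (n - l)%nat x * mu j x ^ l) n)
        with (-1 * (mu j x * sum_f_R0 (fun l => g (n - l)%nat x * mu j x ^ l) n)) by ring.
      rewrite (scal_sum _ n (mu j x)). simpl. f_equal. apply sum_eq. intros; ring. }
    eapply is_derive_eq.
    - apply is_derive_scal.
      apply (is_derive_sum (fun l x => g (n - l)%nat x * mu j x ^ S l)
        (fun l x => dg (n - l)%nat x0 * E e ^ S l)).
      intros l Hl. eapply is_derive_eq.
      + apply Derive.is_derive_mult; [apply (zc_dg _ _ _ _ _ _ Z); lia|].
        now apply is_derive_pow_critical.
      + cbv beta. rewrite Hmu. ring.
    - assert (Hsh := ev_shift n w f g h dg (fun l => E e ^ l) x0 Z).
      unfold ev at 1 in Hsh. rewrite Hsh, F0. ring. }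
  assert (Y0 : y x0 = 0) by (unfold y; rewrite Hmu, G0; ring).
  destruct (Rtotal_order (ev n (fun l => E e ^ l) (fun l => h l x0)) 0) as [Hn|[Hn|Hn]];
    [| easy |].
  - destruct (derive_neg_locally y x0 _ Dy Hn) as [del [Hdel [A B]]].
    exists del. split; [easy|]. intros x1 x2 H1 H2.
    generalize (A x2 H2) (B x1 H1). rewrite Y0. fold (y x1) (y x2). nra.
  - destruct (derive_pos_locally y x0 _ Dy Hn) as [del [Hdel [A B]]].
    exists del. split; [easy|]. intros x1 x2 H1 H2.
    generalize (A x2 H2) (B x1 H1). rewrite Y0. fold (y x1) (y x2). nra.
Qed.

(** The bands lie on the negative axis because the largest branch point is 0; there R < 0 forces z F
    H < 0 with z < 0. *)
Lemma band_product_pos (n j : nat) (f g h E : nat -> R) (t : R) :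
  (forall t : R, t ^ 2 * ev n (fun l => t ^ l) g ^ 2
     + t * ev n (fun l => t ^ l) f * ev n (fun l => t ^ l) h
     = prodn (fun m => t - E m) (2 * n + 2)) ->
  (forall m, (m < 2 * n + 1)%nat -> E m < E (S m)) -> E (2 * n + 1)%nat = 0 ->
  (j <= n)%nat -> E (2 * j)%nat < t < E (2 * j + 1)%nat ->
  0 < ev n (fun l => t ^ l) f * ev n (fun l => t ^ l) h.
Proof.
  intros HR Hinc Htop Hj Ht.
  assert (Hneg := prodn_band_neg E n j t Hinc Hj Ht). rewrite <- HR in Hneg.
  assert (Ht0 : t < 0).
  { generalize (increasing_le E (2 * n + 1) Hinc (2 * j + 1) (2 * n + 1) ltac:(lia)). lra. }
  apply Rnot_le_lt. intros Hle.
  assert (A : 0 <= t ^ 2 * ev n (fun l => t ^ l) g ^ 2)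
    by (apply Rmult_le_pos; apply pow2_ge_0).
  assert (B : 0 <= t * (ev n (fun l => t ^ l) f * ev n (fun l => t ^ l) h)) by nra.
  lra.
Qed.

Theorem theorem5p4 (n : nat) (u : R -> R) (f : nat -> R -> R) (E : nat -> R)
  (* u in C^infinity(R), real-valued *)
  (Hsmooth : smooth u)
  (* d^k u in L^infinity for k = 0, 1, 2 *)
  (Hbdd : forall k : nat, (k <= 2)%nat ->
     exists M : R, forall x : R, Rabs (Derive_n u k x) <= M)
  (* 4u - u_xx > 0 *)
  (Hpos : forall x : R, 0 < 4 * u x - dx2 u x)
  (* the recursion f_0 = 1, f_{l,x} = -2 G(...), f_l fixed up to constants *)
  (Hf0 : forall x : R, f O x = 1)
  (Hrec : forall (l : nat) (x : R), (1 <= l <= n)%nat ->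
     exists I : R,
       is_RInt_gen (fun y => exp (-2 * Rabs (x - y)) * rec_rhs u f l y)
         (Rbar_locally m_infty) (Rbar_locally p_infty) I
       /\ is_derive (f l) x (-2 * (/ 4 * I)))
  (* s-CH_n(u) = 0 *)
  (HsCH : forall x : R, sCH n u f x = 0)
  (* R_{2n+2}(z) = prod_{m=0}^{2n+1} (z - E_m) *)
  (HR : forall x z : R,
     z ^ 2 * (Gpoly n f z x) ^ 2 + z * Fpoly n f z x * Hpoly n u f z x
     = prodn (fun m => z - E m) (2 * n + 2))
  (* E_0 < E_1 < ... < E_{2n+1} = 0 *)
  (Hinc : forall m : nat, (m < 2 * n + 1)%nat -> E m < E (S m))
  (Htop : E (2 * n + 1)%nat = 0) :
  exists mu nu : nat -> R -> R,
    (* mu_1(x),...,mu_n(x) are the (real) zeros of F_n(.,x) *)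
    (forall x z : R, Fpoly n f z x = prodn (fun j => z - mu (S j) x) n)
    (* nu_1(x),...,nu_n(x) are the (real) zeros of H_n(.,x) = h_0 prod (z - nu_j) *)
    /\ (forall x z : R,
          Hpoly n u f z x = hfun n u f O x * prodn (fun j => z - nu (S j) x) n)
    (* localization in the closed gaps (hence increasingly ordered) *)
    /\ (forall (j : nat) (x : R), (1 <= j <= n)%nat ->
          E (2 * j - 1)%nat <= mu j x <= E (2 * j)%nat
          /\ E (2 * j - 1)%nat <= nu j x <= E (2 * j)%nat)
    (* hat mu_j = (mu_j, -mu_j G_n(mu_j)) is C^infinity into K_n *)
    /\ (forall j : nat, (1 <= j <= n)%nat ->
          smooth (mu j) /\ smooth (fun x => - mu j x * Gpoly n f (mu j x) x))
    (* Dubrovin equations on all of R *)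
    /\ (forall (j : nat) (x : R), (1 <= j <= n)%nat ->
          is_derive (mu j) x
            (2 * (- mu j x * Gpoly n f (mu j x) x) / mu j x
             * prodn (fun i => if Nat.eqb (S i) j then 1
                               else / (mu j x - mu (S i) x)) n))
    (* hat mu_j changes sheets whenever mu_j hits E_{2j-1} or E_{2j} *)
    /\ (forall (j : nat) (x0 : R), (1 <= j <= n)%nat ->
          (mu j x0 = E (2 * j - 1)%nat \/ mu j x0 = E (2 * j)%nat) ->
          exists delta : R, 0 < delta /\
            forall x1 x2 : R, x0 - delta < x1 < x0 -> x0 < x2 < x0 + delta ->
              (- mu j x1 * Gpoly n f (mu j x1) x1)
              * (- mu j x2 * Gpoly n f (mu j x2) x2) < 0).
Proof.
  assert (Z := zero_curvature_CH n u f Hsmooth Hbdd Hf0 Hrec HsCH).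
  set (w := wfun u) in Z. set (g := gfun f) in Z. set (h := hfun n u f) in Z.
  set (dg := fun l => Derive (gfun f l)) in Z.
  assert (HR' : forall x t : R, t ^ 2 * ev n (fun l => t ^ l) (fun l => g l x) ^ 2
     + t * ev n (fun l => t ^ l) (fun l => f l x) * ev n (fun l => t ^ l) (fun l => h l x)
     = prodn (fun m => t - E m) (2 * n + 2)) by exact HR.
  assert (Hband : forall x j t, (j <= n)%nat -> E (2 * j)%nat < t < E (2 * j + 1)%nat ->
    0 < ev n (fun l => t ^ l) (fun l => f l x) * ev n (fun l => t ^ l) (fun l => h l x)).
  { intros x j t Hj Ht. now apply (band_product_pos n j _ (fun l => g l x) _ E). }
  assert (FNZ : forall x j t, (j <= n)%nat -> E (2 * j)%nat < t < E (2 * j + 1)%nat ->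
    ev n (fun l => t ^ l) (fun l => f l x) <> 0).
  { intros x j t Hj Ht H0. generalize (Hband x j t Hj Ht). rewrite H0. lra. }
  assert (HNZ : forall x j t, (j <= n)%nat -> E (2 * j)%nat < t < E (2 * j + 1)%nat ->
    ev n (fun l => t ^ l) (fun l => h l x) <> 0).
  { intros x j t Hj Ht H0. generalize (Hband x j t Hj Ht). rewrite H0. lra. }
  assert (FS : forall x j t1 t2, (S j <= n)%nat -> E (2 * j)%nat < t1 < E (2 * j + 1)%nat ->
     E (2 * S j)%nat < t2 < E (2 * S j + 1)%nat ->
     ev n (fun l => t1 ^ l) (fun l => f l x) * ev n (fun l => t2 ^ l) (fun l => f l x) < 0).
  { intros x j t1 t2 Hj H1 H2. apply (sign_alternation n w f g h dg E j x t1 t2); auto.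
    intros t [Ht|Ht]; [apply (FNZ x j) | apply (FNZ x (S j))]; auto; lia. }
  assert (HS : forall x j t1 t2, (S j <= n)%nat -> E (2 * j)%nat < t1 < E (2 * j + 1)%nat ->
     E (2 * S j)%nat < t2 < E (2 * S j + 1)%nat ->
     ev n (fun l => t1 ^ l) (fun l => h l x) * ev n (fun l => t2 ^ l) (fun l => h l x) < 0).
  { intros x j t1 t2 Hj H1 H2. generalize (FS x j t1 t2 Hj H1 H2)
      (Hband x j t1 ltac:(lia) H1) (Hband x (S j) t2 Hj H2).
    generalize (ev n (fun l => t1 ^ l) (fun l => f l x)) (ev n (fun l => t2 ^ l) (fun l => f l x))
      (ev n (fun l => t1 ^ l) (fun l => h l x)) (ev n (fun l => t2 ^ l) (fun l => h l x)).
    intros a b c d Hab Hac Hbd. apply Rnot_le_lt. intros Hcd.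
    assert (0 < (a * c) * (b * d)) by now apply Rmult_lt_0_compat.
    assert ((a * b) * (c * d) <= 0) by nra. lra. }
  assert (RF := fun x => roots_in_gaps E n (fun l => f l x) Hinc (FNZ x) (FS x)).
  assert (RH := fun x => roots_in_gaps E n (fun l => h l x) Hinc (HNZ x) (HS x)).
  (* The zeros are chosen separately for each x, with no regularity built in; the disjoint gaps make
     the labelling consistent. *)
  set (mu := fun j x => proj1_sig (constructive_indefinite_description _ (RF x)) j).
  set (nu := fun j x => proj1_sig (constructive_indefinite_description _ (RH x)) j).
  assert (HF : forall x t, ev n (fun l => t ^ l) (fun l => f l x)
    = prodn (fun i => t - mu (S i) x) n).
  { intros x t.
    eapply eq_trans; [apply (proj2_sig (constructive_indefinite_description _ (RF x)))|].
    change (f 0%nat x * prodn (fun i => t - mu (S i) x) n = prodn (fun i => t - mu (S i) x) n).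
    rewrite (Hf0 x). apply Rmult_1_l. }
  assert (Hloc : forall j x, (1 <= j <= n)%nat ->
    E (2 * j - 1)%nat <= mu j x <= E (2 * j)%nat).
  { intros j x. apply (proj2_sig (constructive_indefinite_description _ (RF x))). }
  assert (Hneg : forall e, (e < 2 * n + 1)%nat -> E e < 0).
  { intros e He. generalize (Hinc e He)
      (increasing_le E (2 * n + 1) Hinc (S e) (2 * n + 1) ltac:(lia)). lra. }
  assert (Smu := zeros_smooth n w f g h dg E mu Z Hinc Hloc HF).
  exists mu, nu. split; [exact HF|]. split; [|split; [|split; [|split]]].
  - intros x. apply (proj2_sig (constructive_indefinite_description _ (RH x))).
  - intros j x Hj. split; [now apply Hloc|].
    now apply (proj2_sig (constructive_indefinite_description _ (RH x))).
  - intros j Hj. split; apply smooth_of_diffn; intros k; [now apply Smu|].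
    apply (diffn_mult k (fun x => - mu j x)).
    + apply (diffn_ext k (fun x => -1 * mu j x)); [intros; ring|]. now apply diffn_scal, Smu.
    + apply (diffn_ev n g (mu j) k); [|now apply Smu].
      intros l Hl. now apply (zc_smooth_g _ _ _ _ _ _ Z).
  (* The quotient 2y/mu_j reduces to -2G, as mu_j < 0 in every gap. *)
  - intros j x Hj. eapply is_derive_eq; [now apply (dubrovin n w f g h dg E mu)|].
    change (Gpoly n f (mu j x) x) with (ev n (fun l => mu j x ^ l) (fun l => g l x)).
    unfold omit. field.
    generalize (Hloc j x Hj) (Hneg (2 * j)%nat ltac:(lia)). lra.
  - intros j x0 Hj [He|He].
    + apply (sheet_change n (2 * j - 1) j w f g h dg E mu x0); auto; [lia|].
      generalize (Hneg (2 * j - 1)%nat ltac:(lia)). lra.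
    + apply (sheet_change n (2 * j) j w f g h dg E mu x0); auto; [lia|].
      generalize (Hneg (2 * j)%nat ltac:(lia)). lra.
Qed.
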